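(* Let $G$ be a closed subgroup of $S_{\infty}$, let $X=\langle X,\tau\rangle$ be a Polish $G$-space with a countable basis consisting of clopen sets, let $t$ be a nice topology for $X$ and let $\mathcal{B}=\{B_l:l\in\omega\}$ be its nice basis. Let $x\in X$ and let $C$ be the piece of the canonical partition with respect to $\mathcal{B}$ containing $x$. Let $\mathbb{A}$ be an admissible set such that $x$ is codable in $\mathbb{A}$ with respect to $\mathcal{B}$ and the relation $Imp$ (with respect to $\mathcal{B}$) is $\Sigma$-definable in $\mathbb{A}$. Then the following are equivalent: (i) $C=Gx$; (ii) $C$ cannot be partitioned into two (nonempty) $G$-invariant Borel sets constructible in $\mathbb{A}$ (with respect to $\mathcal{B}$).
   Context: **Group actions.** $S_\infty$ is the group of all permutations of $\omega$ with its usual Polish topology. A Polish $G$-space is a Polish space $X$ with a continuous action of $G$. $[\omega]^{<\omega}$ is the set of finite subsets of $\omega$; $S_{<\infty}$ is the set of all bijections between finite subsets of $\omega$; $S^G_{<\infty}=\{f|_d : f\in G,\ d\in[\omega]^{<\omega}\}$. For $\sigma\in S^G_{<\infty}$, $V^G_\sigma=\{f\in G: f\supseteq\sigma\}$; for finite $d\subseteq\omega$, $V^G_d=V^G_{id_d}$. $\mathcal{N}^G=\{V^G_\sigma:\sigma\in S^G_{<\infty}\}$. **Nice topology.** For $B\subseteq X$ and open $H\subseteq G$, the Vaught transform is $B^{*H}=\{x\in X:\{g\in H:gx\in B\}\text{ is comeagre in }H\}$. A topology $t$ on $X$ is nice for the $G$-space $(\langle X,\tau\rangle,G)$ if: (a)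 $t$ is Polish, finer than $\tau$, and the $G$-action remains continuous with respect to $t$; (b) there is a basis $\mathcal{B}$ of $t$ such that (i) $\mathcal{B}$ is countable; (ii) $B_1\cap B_2\in\mathcal{B}$ for all $B_1,B_2\in\mathcal{B}$; (iii) $X\setminus B\in\mathcal{B}$ for all $B\in\mathcal{B}$; (iv) $B^{*u}\in\mathcal{B}$ for all $B\in\mathcal{B}$ and $u\in\mathcal{N}^G$; (v) every $B\in\mathcal{B}$ is invariant under some open subgroup $H<G$. A basis satisfying (b) is called a nice basis. **Canonical partition.** The piece containing $x$ of the canonical partition with respect to $\mathcal{B}$ is $C=\bigcap\{GB:B\in\mathcal{B},\ x\in GB\}\cap\bigcap\{X\setminus GB:B\in\mathcal{B},\ x\notin GB\}$. **Admissible sets.** An admissible set $\mathbb{A}$ is a transitive model of KPU (Kripke–Platek set theory with urelements, in the sense of Barwise), regarded as a two-sorted structure in a language $L$ containing $\emptyset,\in$, with the KPU axiom schemes holding for all formulas of $L$. $\Sigma$-definable means definable by a $\Sigma$-formula (parameters allowed). $\omega$ is realizable in $\mathbb{A}$ if $\mathbb{A}$ contains a copy of $\langle\omega,<\rangle$ as an element (possibly consisting of urelements); then $\mathbb{A}$ also contains copies of $[\omega]^{<\omega}$ and $S_{<\infty}$ ordered by inclusion, and these sets are identified with their copies. **Multicodes.** In $\mathbb{A}$ define predicates $B_\Sigma,B_\Pi$ by simultaneous induction on ordinals $\alpha>0$: $B_\Sigma(1,u)$ iff $u$ is a function with $dom[u]=\omega$ and $rng[u]\subseteq\{0,1\}$;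 $B_\Pi(\alpha,u)$ iff $u=(0,u')$ for some $u'$ with $B_\Sigma(\alpha,u')$; for $\alpha>1$, $B_\Sigma(\alpha,u)$ iff $u$ is a function, $dom[u]=\alpha$ if $\alpha$ is limit, $dom[u]=\omega$ if $\alpha$ is a successor, and for every $u'\in rng[u]$ there is $\beta<\alpha$ with $B_\Pi(\beta,u')$ or $B_\Sigma(\beta,u')$. For countable $\alpha$ such $u$ determines a Borel set $B_u$ (with respect to $\mathcal{B}=\{B_l:l\in\omega\}$): if $B_\Sigma(1,u)$ then $B_u=\bigcup\{B_n:u(n)=1\}$; if $B_\Pi(\alpha,u)$ with $u=(0,u')$ then $B_u=X\setminus B_{u'}$; if $\alpha>1$ and $B_\Sigma(\alpha,u)$ then $B_u=\bigcup\{B_{u'}:u'\in rng[u]\}$. A Borel set is constructible in $\mathbb{A}$ if it equals $B_u$ for some $u\in\mathbb{A}$ with $\mathbb{A}\models B_\Sigma(\alpha,u)$ or $\mathbb{A}\models B_\Pi(\alpha,u)$ for some countable ordinal $\alpha\in\mathbb{A}$. **Codability and $Imp$.** $x\in X$ is codable in $\mathbb{A}$ with respect to $\mathcal{B}$ if $\omega$ is realizable in $\mathbb{A}$ and the function $F_1:S_{<\infty}\to\mathbb{A}$ given by $F_1(\sigma)=\emptyset$ if $\sigma\notin S^G_{<\infty}$ and $F_1(\sigma)=\{l: V^G_\sigma x\cap B_l\neq\emptyset\}$ if $\sigma\in S^G_{<\infty}$ is an element of $\mathbb{A}$. The relation $Imp(c,l,k)$ holds iff $c\in[\omega]^{<\omega}$,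 $l,k\in\omega$ and $B_k\subseteq V^G_cB_l$. *)

(* Defs.v *)
From HB Require Import structures.
From mathcomp Require Import all_boot all_order all_algebra finmap.
From mathcomp Require Import all_classical all_reals all_analysis.

Set Implicit Arguments.
Unset Strict Implicit.
Unset Printing Implicit Defensive.

Local Open Scope classical_set_scope.

Section PolishSpaces.

(* Separable and homeomorphic to a complete metric space; completeness is
   convergence of all Cauchy filters. *)
Definition polish (R : realType) (T : topologicalType) : Prop :=
  (exists2 D : set T, countable D & dense D) /\
  exists (M : metricType R) (f : T -> M) (g : M -> T),
    [/\ cancel f g, cancel g f, continuous f, continuous g &
        forall F : set_system M, ProperFilter F -> cauchy F ->
          exists y : M, F --> y].

Definition nowhere_dense (T : topologicalType) (A : set T) : Prop :=
  interior (closure A) = set0.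

Definition meagre (T : topologicalType) (A : set T) : Prop :=
  exists F : nat -> set T,
    (forall n, nowhere_dense (F n)) /\ A = \bigcup_n F n.

Definition comeagre (T : topologicalType) (A : set T) : Prop := meagre (~` A).

(* [H] is viewed as a topological space by itself, through [set_type]. *)
Definition comeagre_in (T : topologicalType) (H A : set T) : Prop :=
  comeagre [set h : set_type H | A (set_val h)].

(* A set may carry several topologies: they are given as [Topological]
   structures on a common carrier. *)
Definition space (X : Type) (t : Topological X) : topologicalType :=
  Topological.Pack t.

End PolishSpaces.

Section GroupActions.

(* Pointwise convergence, [nat] being discrete.  Permutation groups are subsets
   of this space, with the subspace topology. *)
Definition baire := {ptws nat -> nat}.

Definition S_infty : set baire := [set f | bijective f].

Definition subgroup (H G : set baire) : Prop :=
  [/\ H `<=` G,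
      H idfun,
      forall f g : baire, H f -> H g -> H (f \o g) &
      forall f : baire, H f ->
        exists g : baire, [/\ H g, cancel f g & cancel g f]].

Definition closed_subgroup (G : set baire) : Prop :=
  subgroup G S_infty /\ exists2 F, closed F & G = S_infty `&` F.

Definition open_subgroup (G H : set baire) : Prop :=
  subgroup H G /\ exists2 U, open U & H = G `&` U.

(* An action of [G] is given by a map on the whole of [baire]; its values
   outside [G] are never used. *)
Definition is_action (G : set baire) (X : Type) (act : baire -> X -> X) : Prop :=
  (forall x, act idfun x = x) /\
  forall f g x, G f -> G g -> act (f \o g) x = act f (act g x).

Definition continuous_action (G : set baire) (X : topologicalType)
    (act : baire -> X -> X) : Prop :=
  {within G `*` [set: X], continuous (fun p : baire * X => act p.1 p.2)}.

Definition polish_gspace (R : realType) (G : set baire) (X : topologicalType)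
    (act : baire -> X -> X) : Prop :=
  [/\ polish R X, is_action G act & continuous_action G act].

(* [setact act H A] is HA. *)
Definition setact (X : Type) (act : baire -> X -> X) (H : set baire)
    (A : set X) : set X :=
  [set act h a | h in H & a in A].

Definition gorbit (X : Type) (act : baire -> X -> X) (G : set baire) (x : X) :=
  setact act G [set x].

Definition invariant_under (X : Type) (act : baire -> X -> X) (H : set baire)
    (A : set X) : Prop :=
  forall h, H h -> act h @` A = A.

(* S_{<oo}: bijections between finite subsets of nat *)
Definition Sfin : set {fmap nat -> nat} := [set s | injective (fun n : domf s => s n)].

Definition fres (f : nat -> nat) (d : {fset nat}) : {fmap nat -> nat} :=
  [fmap n : d => f (val n)]%fmap.

Definition SfinG (G : set baire) : set {fmap nat -> nat} :=
  [set fres f d | f in G & d in [set: {fset nat}]].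

(* V^G_s *)
Definition Vstab (G : set baire) (s : {fmap nat -> nat}) : set baire :=
  [set f | G f /\ forall n : domf s, f (val n) = s n].

(* V^G_d *)
Definition Vfix (G : set baire) (d : {fset nat}) : set baire :=
  Vstab G (fres idfun d).

Definition Nfam (G : set baire) : set (set baire) :=
  [set Vstab G s | s in SfinG G].

(* the Vaught transform B^{*H} *)
Definition vaught (X : Type) (act : baire -> X -> X) (B : set X)
    (H : set baire) : set X :=
  [set x | comeagre_in H [set g | B (act g x)]].

End GroupActions.

Section NiceTopologies.

Definition nice_basis (G : set baire) (X : topologicalType)
    (act : baire -> X -> X) (t : Topological X) (Bs : set (set X)) : Prop :=
  [/\ @basis (space t) Bs /\ countable Bs,
      forall B1 B2, Bs B1 -> Bs B2 -> Bs (B1 `&` B2),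
      forall B, Bs B -> Bs (~` B),
      forall B u, Bs B -> Nfam G u -> Bs (vaught act B u) &
      forall B, Bs B -> exists2 H, open_subgroup G H & invariant_under act H B].

Definition nice_topology (R : realType) (G : set baire) (X : topologicalType)
    (act : baire -> X -> X) (t : Topological X) : Prop :=
  [/\ polish R (space t),
      forall U : set X, open U -> @open (space t) U,
      @continuous_action G (space t) act &
      exists Bs, nice_basis G act t Bs].

Definition canonical_piece (G : set baire) (X : Type) (act : baire -> X -> X)
    (Bs : set (set X)) (x : X) : set X :=
  (\bigcap_(B in [set B | Bs B /\ setact act G B x]) setact act G B) `&`
  (\bigcap_(B in [set B | Bs B /\ ~ setact act G B x]) ~` setact act G B).

Definition Imp (G : set baire) (X : Type) (act : baire -> X -> X)
    (B : nat -> set X) (c : {fset nat}) (l k : nat) : Prop :=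
  B k `<=` setact act (Vfix G c) (B l).

End NiceTopologies.

Section Language.

Record language := Language {
  fsym : Type; far : fsym -> nat;
  rsym : Type; rar : rsym -> nat }.

(* The symbols of [L] come in addition to equality, membership, the constant
   for the empty set and the predicate "is a set", which tells the two sorts
   apart.  Variables range over both sorts, so that quantifiers over a single
   sort are (bounded or unbounded) relativizations to this predicate. *)
Inductive term (L : language) : Type :=
| Var of nat
| Empty
| App (f : fsym L) of ('I_(far f) -> term L).

Inductive formula (L : language) : Type :=
| FIsSet of term L
| FEq of term L & term L
| FIn of term L & term L
| FRel (r : rsym L) of ('I_(rar r) -> term L)
| FNot of formula L
| FAnd of formula L & formula L
| FOr of formula L & formula L
| FAll of nat & formula L
| FEx of nat & formula L
| FBAll of nat & nat & formula L (* [FBAll x y p]: for all x in y, p *)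
| FBEx of nat & nat & formula L.

Fixpoint is_delta0 L (p : formula L) : bool :=
  match p with
  | FIsSet _ | FEq _ _ | FIn _ _ | FRel _ _ => true
  | FNot q | FBAll _ _ q | FBEx _ _ q => is_delta0 q
  | FAnd q r | FOr q r => is_delta0 q && is_delta0 r
  | FAll _ _ | FEx _ _ => false
  end.

Fixpoint is_sigma L (p : formula L) : bool :=
  is_delta0 p ||
  match p with
  | FAnd q r | FOr q r => is_sigma q && is_sigma r
  | FEx _ q | FBAll _ _ q | FBEx _ _ q => is_sigma q
  | _ => false
  end.

Record structure (L : language) := Structure {
  urel : Type;
  hset : Type;
  smem : urel + hset -> hset -> Prop;
  emp : hset;
  fint : forall f : fsym L, ('I_(far f) -> urel + hset) -> urel + hset;
  rint : forall r : rsym L, ('I_(rar r) -> urel + hset) -> Prop }.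

Definition elt L (A : structure L) : Type := (urel A + hset A)%type.

(* Membership on all of the universe; urelements have no members. *)
Definition isin L (A : structure L) (v w : elt A) : Prop :=
  if w is inr a then smem v a else False.

Definition upd L (A : structure L) (e : nat -> elt A) (n : nat) (v : elt A) :
    nat -> elt A :=
  fun m => if m == n then v else e m.

Fixpoint eval L (A : structure L) (e : nat -> elt A) (u : term L) : elt A :=
  match u with
  | Var n => e n
  | Empty => inr (emp A)
  | App f us => fint (fun i => eval e (us i))
  end.

Fixpoint sat L (A : structure L) (e : nat -> elt A) (p : formula L) : Prop :=
  match p with
  | FIsSet u => exists a, eval e u = inr a
  | FEq u v => eval e u = eval e v
  | FIn u v => isin (eval e u) (eval e v)
  | FRel r us => rint (fun i => eval e (us i))
  | FNot q => ~ sat e q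
  | FAnd q r => sat e q /\ sat e r
  | FOr q r => sat e q \/ sat e r
  | FAll n q => forall v, sat (upd e n v) q
  | FEx n q => exists v, sat (upd e n v) q
  | FBAll n m q => forall v, isin v (e m) -> sat (upd e n v) q
  | FBEx n m q => exists2 v, isin v (e m) & sat (upd e n v) q
  end.

End Language.

Section AdmissibleSets.

Variables (L : language) (A : structure L).
Implicit Types (e : nat -> elt A) (p : formula L) (a b : hset A).

Definition extensionality_axiom : Prop :=
  forall a b, (forall v, smem v a <-> smem v b) -> a = b.

Definition empty_set_axiom : Prop := forall v, ~ smem v (emp A).

Definition foundation_axiom : Prop :=
  forall p e n, (exists v, sat (upd e n v) p) ->
    exists2 v, sat (upd e n v) p &
      forall w, isin w v -> ~ sat (upd e n w) p.

Definition pairing_axiom : Prop := forall v w, exists a, smem v a /\ smem w a.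

Definition union_axiom : Prop :=
  forall a, exists b, forall v w, smem w a -> isin v w -> smem v b.

Definition delta0_separation : Prop :=
  forall p e n a, is_delta0 p ->
    exists b, forall v, smem v b <-> smem v a /\ sat (upd e n v) p.

Definition delta0_collection : Prop :=
  forall p e n m a, is_delta0 p ->
    (forall v, smem v a -> exists w, sat (upd (upd e n v) m w) p) ->
    exists b, forall v, smem v a ->
      exists2 w, smem w b & sat (upd (upd e n v) m w) p.

Definition KPU : Prop :=
  [/\ extensionality_axiom, empty_set_axiom & foundation_axiom] /\
  [/\ pairing_axiom, union_axiom, delta0_separation & delta0_collection].

(* By Mostowski collapse, the transitive models are, up to isomorphism, the
   extensional models whose membership relation is really well-founded. *)
Definition admissible : Prop := KPU /\ well_founded (@isin L A).

(* A relation on the universe is Sigma-definable with parameters; the arguments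
   are the variables 0, 1, 2, all other variables hold parameters. *)
Definition sigma_definable3 (Q : elt A -> elt A -> elt A -> Prop) : Prop :=
  exists p e, is_sigma p /\
    forall u v w, sat (upd (upd (upd e 0 u) 1 v) 2 w) p <-> Q u v w.

(* [z] is the set, in the structure, of all [v] with [P v]. *)
Definition is_ext (z : elt A) (P : elt A -> Prop) : Prop :=
  exists2 a, z = inr a & forall v, smem v a <-> P v.

(* Kuratowski pairs *)
Definition is_pair (z v w : elt A) : Prop :=
  exists s d, [/\ is_ext s (fun y => y = v),
                  is_ext d (fun y => y = v \/ y = w) &
                  is_ext z (fun y => y = s \/ y = d)].

Definition is_zero (z : elt A) : Prop := z = inr (emp A).

Definition is_one (z : elt A) : Prop := is_ext z is_zero.

Definition is_set (z : elt A) : Prop := exists a, z = inr a.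

Definition transitive_set (z : elt A) : Prop :=
  is_set z /\ forall v w, isin v z -> isin w v -> isin w z.

Definition is_ordinal (z : elt A) : Prop :=
  transitive_set z /\ forall v, isin v z -> transitive_set v.

Definition succ_ordinal (z : elt A) : Prop :=
  exists2 beta, is_ordinal beta & is_ext z (fun v => isin v beta \/ v = beta).

Definition gt_one (z : elt A) : Prop :=
  is_ordinal z /\ exists2 o, is_one o & isin o z.

Definition is_fun (u : elt A) : Prop :=
  [/\ is_set u,
      forall q, isin q u -> exists v w, is_pair q v w &
      forall q r v w w', isin q u -> isin r u -> is_pair q v w -> is_pair r v w' ->
        w = w'].

Definition maps (u v w : elt A) : Prop := exists2 q, isin q u & is_pair q v w.

Definition fdom (u v : elt A) : Prop := exists w, maps u v w.

Definition frng (u w : elt A) : Prop := exists v, maps u v w.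

(* The structure contains, as an element, a copy of (omega, <), [iota] being
   the isomorphism from the standard natural numbers onto this copy. *)
Definition omega_copy (iota : nat -> elt A) : Prop :=
  [/\ injective iota,
      exists W, is_ext W (fun v => exists n, v = iota n) &
      exists r, is_ext r (fun q =>
        exists m n, (m < n)%N /\ is_pair q (iota m) (iota n))].

Section Coding.

Variable iota : nat -> elt A.

(* Given the copy [iota] of omega, finite sets and finite partial maps of
   natural numbers are identified with the corresponding sets and sets of pairs
   of elements of the copy. *)
Definition fset_code (c : {fset nat}) (z : elt A) : Prop :=
  is_ext z (fun v => exists2 n, n \in c & v = iota n).

Definition fmap_code (s : {fmap nat -> nat}) (z : elt A) : Prop :=
  is_ext z (fun q => exists n : domf s, is_pair q (iota (val n)) (iota (s n))).

Definition Imp_rel (G : set baire) (X : Type) (act : baire -> X -> X)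
    (B : nat -> set X) (u v w : elt A) : Prop :=
  exists c l k,
    [/\ fset_code c u, v = iota l, w = iota k & Imp G act B c l k].

Section Codability.

Variables (G : set baire) (X : Type) (act : baire -> X -> X) (B : nat -> set X).
Variable x : X.

Definition F1_val (s : {fmap nat -> nat}) (y : elt A) : Prop :=
  (~ SfinG G s -> y = inr (emp A)) /\
  (SfinG G s -> is_ext y (fun v => exists2 l,
     v = iota l & setact act (Vstab G s) [set x] `&` B l !=set0)).

Definition F1_entry (s : {fmap nat -> nat}) (q : elt A) : Prop :=
  exists z y, [/\ fmap_code s z, F1_val s y & is_pair q z y].

(* omega is realizable, by [iota], and the graph of F_1 is an element of the
   structure *)
Definition codable : Prop :=
  omega_copy iota /\
  exists f : hset A,
    (forall s, Sfin s -> exists2 q, smem q f & F1_entry s q) /\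
    (forall q, smem q f -> exists2 s, Sfin s & F1_entry s q).

End Codability.

(* The recursion on ordinals defining multicodes, as an inductive predicate.
   It only involves quantifiers bounded in the structure, hence coincides with
   its evaluation inside an admissible set. *)
Inductive BSigma : elt A -> elt A -> Prop :=
| BSigma_one o u :
    is_one o -> is_fun u ->
    (forall v, fdom u v <-> exists n, v = iota n) ->
    (forall w, frng u w -> is_zero w \/ is_one w) ->
    BSigma o u
| BSigma_gt1 alpha u :
    gt_one alpha -> is_fun u ->
    (~ succ_ordinal alpha -> forall v, fdom u v <-> isin v alpha) ->
    (succ_ordinal alpha -> forall v, fdom u v <-> exists n, v = iota n) ->
    (forall w, frng u w ->
      exists2 beta, isin beta alpha & BPi beta w \/ BSigma beta w) ->
    BSigma alpha u
with BPi : elt A -> elt A -> Prop :=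
| BPi_compl alpha u o w :
    is_zero o -> is_pair u o w -> BSigma alpha w -> BPi alpha u.

Section Decoding.

Variables (X : Type) (B : nat -> set X).

(* [decode u S]: the multicode [u] determines the set [S] *)
Inductive decode : elt A -> set X -> Prop :=
| decode_one o u :
    is_one o -> BSigma o u ->
    decode u (\bigcup_(n in [set n | maps u (iota n) o]) B n)
| decode_compl alpha u o w S :
    BPi alpha u -> is_zero o -> is_pair u o w -> decode w S -> decode u (~` S)
| decode_gt1 alpha u (F : elt A -> set X) :
    gt_one alpha -> BSigma alpha u ->
    (forall w, frng u w -> decode w (F w)) ->
    decode u (\bigcup_(w in [set w | frng u w]) F w).

(* A Borel set of the topology [t] which is constructible.  The ordinal is
   required to be countable in the real world. *)
Definition constructible_borel (t : Topological X) (S : set X) : Prop :=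
  <<s [set U : set X | @open (space t) U] >> S /\
  exists alpha u, [/\ is_ordinal alpha, countable [set v | isin v alpha],
                  BSigma alpha u \/ BPi alpha u & decode u S].

End Decoding.
End Coding.
End AdmissibleSets.

(* Main.v *)
Require Import Defs.
From Stdlib Require List.
From HB Require Import structures.
From mathcomp Require Import all_boot all_order all_algebra finmap.
From mathcomp Require Import all_classical all_reals all_analysis.

(** Write V_n for the elements of G fixing 0, ..., n-1, and say that y and z have
    the same n-type when V_n y and V_n z meet the same basic sets.  Since the
    nice basis is closed under Vaught transforms, V_n B_l is again basic, hence
    clopen; so the points with the n-type of z are exactly those in the closure
    of V_n z, and C is the closure of Gx.

    A basic set isolates an n-type if the points of Gx lying in it all have the
    same n-type; a point is atomic if for every n it lies in such a set.  Two
    atomic points of C are in the same orbit, by back-and-forth.  Suppose C is not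
    Gx.  If x is atomic, then the non-atomic points form an invariant set S which
    separates Gx from the rest of C.  If x has a non-isolated n-type, then the set
    S of all points whose orbit realizes the n-type of x is meagre in C, because
    it is the union of countably many translates of the closure of V_n x, and so
    S is again a proper part of C.

    In both cases S is the union over m of the closed sets obtained by removing
    all B_l with theta(m, l), where theta is Delta_0 in the function F_1: in the
    second case one takes the closures of {hx : h maps {0..n-1} into {0..m-1}},
    which avoids enumerating finite partial maps inside the admissible set.
    Delta_0 separation and collection then give multicodes of S at level 2 and of
    C \ S at level 3. *)

Set Implicit Arguments.
Unset Strict Implicit.
Unset Printing Implicit Defensive.
Local Open Scope classical_set_scope.

(** * The topology of permutation groups *)

Definition agree (n : nat) (f g : nat -> nat) := forall i, (i < n)%N -> f i = g i.

Lemma nbhs_agree (f : baire) n : nbhs f [set h : baire | agree n h f].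
Proof.
elim: n => [|n IH]; first by apply: filterS filterT => h _ i.
have cn : nbhs f [set h : baire | h n = f n].
  by apply: (@proj_continuous nat (fun=> nat) n f [set f n]); apply: discrete_set1.
near=> h => i; rewrite ltnS leq_eqVlt => /orP[/eqP->|].
  by near: h.
by apply: (near IH h).
Unshelve. all: by end_near.
Qed.

Lemma nbhs_agreeP (f : baire) (U : set baire) :
  nbhs f U -> exists n, forall h : baire, agree n h f -> U h.
Proof.
move=> fU.
have FF : Filter (filter_from setT (fun n => [set h : baire | agree n h f])).
  apply: filter_from_filter; first by exists 0%N.
  move=> i j _ _; exists (maxn i j) => // h hf; split=> k ki; apply: hf;
    by rewrite (leq_trans ki) // ?leq_maxl ?leq_maxr.
have : filter_from setT (fun n => [set h : baire | agree n h f]) --> f.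
  apply/cvg_sup => i W [V [[Z oZ <-] /= Zf ZW]]; exists i.+1 => // h /= hf.
  by apply: ZW; rewrite /= hf.
by case/(_ _ fU) => n _ nU; exists n.
Qed.

Lemma agree_sym n f g : agree n f g -> agree n g f.
Proof. by move=> fg i /fg. Qed.

Lemma agree_trans n f g h : agree n f g -> agree n g h -> agree n f h.
Proof. by move=> fg gh i ni; rewrite fg ?gh. Qed.

Lemma agreeW m n f g : (m <= n)%N -> agree n f g -> agree m f g.
Proof. by move=> mn fg i im; apply: fg; apply: leq_trans mn. Qed.

Section ClosedSubgroup.
Variables (G : set baire) (hG : closed_subgroup G).

Lemma group_id : G idfun. Proof. by case: hG => -[]. Qed.

Lemma group_comp f g : G f -> G g -> G (f \o g).
Proof. by case: hG => -[_ _ + _] _; exact. Qed.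

Lemma group_inv f : G f -> exists g, [/\ G g, cancel f g & cancel g f].
Proof. by case: hG => -[_ _ _ +] _; exact. Qed.

(** The agreement hypothesis makes the sequence converge pointwise. The last hypothesis freezes
    every argument once its value is below the stage, so the inverses converge too and the limit is
    surjective. This is essential, since [G] is closed only inside the non-closed set [S_infty]. *)
Lemma group_lim (u : nat -> baire) :
  (forall k, G (u k)) ->
  (forall k, agree k (u k.+1) (u k)) ->
  (forall k i, (u k i < k)%N -> u k.+1 i = u k i) ->
  exists2 v, G v & forall k, agree k v (u k).
Proof.
move=> Gu ua uj.
have ag k m : (k <= m)%N -> agree k (u m) (u k).
  move=> /subnKC <-; elim: (m - k)%N => [|d IH]; first by rewrite addn0.
  rewrite addnS; apply: agree_trans IH.
  by apply: agreeW (ua _); exact: leq_addr.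
have uinv k m i : (k <= m)%N -> (u k i < k)%N -> u m i = u k i.
  move=> /subnKC <- ik; elim: (m - k)%N => [|d IH]; first by rewrite addn0.
  by rewrite addnS uj ?IH // (leq_trans ik) // leq_addr.
pose v : baire := fun i => u i.+1 i.
have vu n : agree n v (u n).
  by move=> i ni; rewrite /v (ag _ _ ni).
have [_ [F cF GF]] := hG.
have uF k : S_infty (u k) /\ F (u k) by have := Gu k; rewrite GF.
have vinj : injective v.
  move=> i j; pose k := (maxn i j).+1.
  rewrite (vu k) ?ltnS ?leq_maxl // (vu k) ?ltnS ?leq_maxr //.
  by case: (uF k) => /bij_inj + _; exact.
have vsurj j : exists i, v i = j.
  have [[g _ gK] _] := uF j.+1; exists (g j).
  have e : u j.+1 (g j) = j by exact: gK.
  rewrite (vu (maxn j.+1 (g j).+1)) ?leq_maxr//.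
  by rewrite (uinv j.+1) ?leq_maxl ?e.
have [g gP] := choice vsurj.
exists v => //; rewrite GF; split.
  by exists g => // i; apply: vinj.
rewrite (iffLR (closure_id F) cF) => U /nbhs_agreeP [n nU].
by exists (u n); split; [case: (uF n)|exact/nU/agree_sym/vu].
Qed.

Definition pfix n : set baire := [set h : baire | G h /\ agree n h idfun].

Lemma pfix_id n : pfix n idfun. Proof. by split=> //; exact: group_id. Qed.

Lemma pfix_comp n f g : pfix n f -> pfix n g -> pfix n (f \o g).
Proof.
move=> [Gf fn] [Gg gn]; split; first exact: group_comp.
by move=> i ni; rewrite /= gn// fn.
Qed.

Lemma pfix_inv n f g : pfix n f -> G g -> cancel f g -> pfix n g.
Proof. by move=> [_ fn] Gg fg; split=> // i ni; have := fg i; rewrite (fn i ni). Qed.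

Lemma nbhs_set_type (H : set baire) (h : set_type H) (U : set (set_type H)) :
  nbhs h U <-> exists n, forall h', agree n (set_val h') (set_val h) -> U h'.
Proof.
split.
  case=> _ [[V oV <-] /= Vh VU].
  have /nbhs_agreeP[n nV] : nbhs (set_val h : baire) V.
    exact: open_nbhs_nbhs.
  by exists n => h' /nV; exact: VU.
case=> n nU; apply: (filterS nU).
exact: (@initial_continuous (set_type H) baire set_val h _ (nbhs_agree _ n)).
Qed.

(** The Baire property of $V_n$: no neighbourhood of [h] is covered by a meagre set. Shrinking
    neighbourhoods avoid the sets [F k] one by one, while inverses are controlled so that
    [group_lim] yields a limit in $G$. *)
Lemma meagre_pfix n (A : set (set_type (pfix n))) (h : set_type (pfix n)) m :
  meagre A -> exists2 h' : set_type (pfix n),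
    agree m (set_val h') (set_val h) & ~ A h'.
Proof.
move=> [F [Fnd ->]]; pose H := set_type (pfix n).
have Hg (g : H) : pfix n (set_val g) by exact: set_valP.
(* A pair [(g, N)] stands for the neighbourhood of all elements agreeing with [g] below [N]. The
   third clause puts the preimages of 0, ..., k below the new bound, so they never change
   afterwards. *)
have step (k : nat) (s : H * nat) : exists s' : H * nat,
  [/\ agree s.2 (set_val s'.1) (set_val s.1), (s.2 <= s'.2)%N /\ (k < s'.2)%N,
      forall i, (set_val s'.1 i <= k)%N -> (i < s'.2)%N &
      forall g : H, agree s'.2 (set_val g) (set_val s'.1) -> ~ F k g].
  case: s => g N /=.
  have [g' gg' nF] : exists2 g' : H, agree N (set_val g') (set_val g) &
      ~ closure (F k) g'.
    apply: contrapT => nex.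
    have : interior (closure (F k)) g.
      apply/nbhs_set_type; exists N => g' gg'; apply: contrapT => ng'.
      by apply: nex; exists g'.
    by rewrite Fnd.
  have : exists2 U, nbhs g' U & ~ (F k `&` U !=set0).
    by apply: contrapT => nex; apply: nF => U gU; apply: contrapT => ?; apply: nex; exists U.
  case=> U /nbhs_set_type[n' n'U] FU.
  have [ig [Gig igK Kig]] := group_inv (Hg g').1.
  (* [M] exceeds the preimages of 0, ..., k under [g']. *)
  pose M := (\max_(j < k.+1) ig j).+1.
  exists (g', maxn (maxn N n') (maxn k.+1 M)); split => //=.
  - by rewrite !leq_max !leqnn !orbT.
  - move=> i ik; rewrite !leq_max; apply/orP; right; apply/orP; right.
    rewrite ltnS -[leqLHS]igK.
    by apply: (@leq_bigmax _ (fun j : 'I_k.+1 => ig j) (Ordinal (ik : _ < k.+1)%N)).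
  - move=> g0 g0g' Fg0; apply: FU; exists g0; split=> //; apply: n'U.
    by apply: agreeW g0g'; rewrite !leq_max leqnn orbT.
have [nxt nxtP] := choice (fun p : nat * (H * nat) => step p.1 p.2).
(* Starting at [maxn m n] secures both the required agreement with [h] below [m] and membership of
   the limit in $V_n$. *)
pose s := fix s k := if k is k'.+1 then nxt (k', s k') else (h, maxn m n).
have sP k : _ := nxtP (k, s k).
have sk k : (k <= (s k).2)%N by case: k => // k; case: (sP k) => _ [_ +] _ _; exact.
have sm k : ((s k).2 <= (s k.+1).2)%N by case: (sP k) => _ [+ _] _ _; exact.
have sinv k i : (set_val (s k).1 i < k)%N -> (i < (s k).2)%N.
  by case: k => // k; rewrite ltnS; case: (sP k) => _ _ + _; exact.
have sag k : agree (s k).2 (set_val (s k.+1).1) (set_val (s k).1).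
  by case: (sP k).
have sagm k j : (k <= j)%N -> agree (s k).2 (set_val (s j).1) (set_val (s k).1).
  move=> /subnKC <-; elim: (j - k)%N => [|d IH]; first by rewrite addn0.
  rewrite addnS; apply: agree_trans IH; apply: agreeW (sag _).
  elim: d => [|d IH]; first by rewrite addn0.
  by rewrite (leq_trans IH) // addnS.
have [v Gv vs] : exists2 v, G v & forall k, agree k v (set_val (s k).1).
  apply: group_lim.
  - by move=> k; case: (Hg (s k).1).
  - by move=> k; apply: agreeW (sag k).
  - by move=> k i /sinv; exact: sag.
have vs2 k : agree (s k).2 v (set_val (s k).1).
  apply: (@agree_trans _ _ (set_val (s (maxn k (s k).2)).1)).
    by apply: agreeW (vs _); rewrite leq_maxr.
  by apply: sagm; rewrite leq_maxl.
have v0 : agree (maxn m n) v (set_val h) by exact: (vs2 0%N).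
have Vv : pfix n v.
  split=> //; apply: (@agree_trans _ _ (set_val h)).
    by apply: agreeW v0; rewrite leq_maxr.
  by case: (Hg h).
exists (SigSub (mem_set Vv)); first by apply: agreeW v0; rewrite leq_maxl.
case=> k _; case: (sP k) => _ _ _; apply; exact: (vs2 k.+1).
Qed.

End ClosedSubgroup.

(** * The Baire category theorem in a closed subset of a Polish space *)

Section BaireCategory.
Import Order.TTheory GRing.Theory Num.Theory.

(** Nowhere density of each [E j] relative to [C] is expressed through a clopen basis, which avoids
    a subspace topology on [C]. One chooses nested basic sets meeting [C], the stage after [j]
    missing [E j] and having its image in the complete metric space inside a ball of radius 1/(j+1).
    The images of their traces on [C] generate a Cauchy filter, whose limit pulls back to the point
    sought. *)
Lemma polish_baire (R : realType) (T : topologicalType) (I : Type) (B : I -> set T)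
    (C : set T) (E : nat -> set T) :
  polish R T -> closed C -> C !=set0 ->
  (forall i, closed (B i)) ->
  (forall y (U : set T), nbhs y U -> exists2 i, B i y & B i `<=` U) ->
  (forall j i, B i `&` C !=set0 ->
    exists2 k, (B i `&` B k) `&` C !=set0 & B k `&` E j = set0) ->
  (forall i y, B i y -> nbhs y (B i)) ->
  exists2 y, C y & forall j, ~ E j y.
Proof.
move=> [_ [M [f [g [fgK gfK cf cg complete]]]]] cC [c0 Cc0] clB bB dE oB.
(* When [B i] misses [C], the index [i] itself is a dummy value; along the sequence built below this
   never occurs. *)
have step (p : nat * I) : exists i', B p.2 `&` C !=set0 ->
    [/\ B i' `&` C !=set0, B i' `<=` B p.2, B i' `&` E p.1 = set0 &
     exists z, f @` B i' `<=` ball z (p.1.+1%:R^-1 : R)%R].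
  case: p => j i /=; have [ne|] := pselect (B i `&` C !=set0); last by exists i.
  have [k [z [[iz kz] Cz]] kE] := dE j i ne.
  have : nbhs z ((B i `&` B k) `&` f @^-1` ball (f z) (j.+1%:R^-1 : R)%R).
    apply: filterI; first by apply: filterI; exact: oB.
    by apply: cf; apply: nbhsx_ballx; rewrite invr_gt0 ltr0n.
  move=> /bB[i' i'z i'U]; exists i' => _; split.
  - by exists z.
  - by move=> w /i'U[[]].
  - by rewrite -subset0 => w [/i'U[[_ kw] _] Ew]; rewrite -kE.
  - by exists (f z) => _ [w /i'U[_ ?] <-].
have [nxt nxtP] := choice step.
have [i0 i0c _] : exists2 i, B i c0 & B i `<=` setT by apply: bB; exact: filterT.
pose s := fix s k := if k is k'.+1 then nxt (k', s k') else i0.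
have sC k : B (s k) `&` C !=set0.
  by elim: k => [|k /(nxtP (k, s k))[]//]; exists c0.
have sP k := nxtP (k, s k) (sC k).
have sm j k : (j <= k)%N -> B (s k) `<=` B (s j).
  move=> /subnKC <-; elim: (k - j)%N => [|d IH]; first by rewrite addn0.
  by rewrite addnS; case: (sP (j + d)%N) => _ + _ _; move=> /subset_trans; apply.
pose F : set_system M := filter_from setT (fun k => f @` (B (s k) `&` C)).
have FF : ProperFilter F.
  apply: filter_from_proper.
    apply: filter_from_filter; first by exists 0%N.
    move=> i j _ _; exists (maxn i j) => // _ [w [wB Cw] <-].
    by split; exists w => //; split=> //; apply: sm wB; rewrite ?leq_maxl ?leq_maxr.
  by move=> k _; have [w wP] := sC k; exists (f w), w.
have [z Fz] : exists z : M, F --> z.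
  apply: (complete F); apply: (@cauchy_exP R M F)  => _/posnumP[e].
  have [k kE] : exists k : nat, (k.+1%:R^-1 < e%:num :> R)%R.
    have [k _ kP] := near_infty_natSinv_lt e.
    by exists k; apply: kP => /=.
  have [_ _ _ [z zP]] := sP k; exists z.
  exists k.+1 => // _ [w [wB _] <-]; apply: (@le_ball _ _ _ (k.+1%:R^-1)%R); first exact: ltW.
  by apply: zP; exists w.
have gz k : (B (s k) `&` C) (g z).
  have cl : closed (B (s k) `&` C) by apply: closedI.
  apply: (closed_cvg (F := F) (u_ := g) _ cl); last first.
    by apply: continuous_cvg => //; exact: cg.
  by exists k => // _ [w wP <-]; rewrite fgK.
exists (g z); first by case: (gz 0%N).
move=> j Ej; have [_ _ nE _] := sP j.
have : (B (s j.+1) `&` E j) (g z) by split=> //; case: (gz j.+1).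
by rewrite nE.
Qed.

End BaireCategory.

(** * Types, isolation and atomic points *)

Lemma bounded_below (f : nat -> nat) n : exists m, forall i, (i < n)%N -> (f i < m)%N.
Proof.
exists (\max_(j < n) f j).+1 => i ni; rewrite ltnS.
exact: (@leq_bigmax _ (fun j : 'I_n => f j) (Ordinal ni)).
Qed.

Section Dynamics.
Variables (G : set baire) (hG : closed_subgroup G) (T : topologicalType).
Variables (act : baire -> T -> T) (hact : is_action G act) (B : nat -> set T).

(** This is the saturation $V_nB_l$: as $V_n$ is a group, moving [y] into $B_l$ is the same as
    reaching [y] from $B_l$. *)
Definition psat n l : set T := [set y | exists2 h, pfix G n h & B l (act h y)].

Hypothesis cact : forall g y (U : set T), G g -> nbhs (act g y) U ->
  exists n, exists2 V, nbhs y V &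
    forall h z, G h -> agree n h g -> V z -> U (act h z).
Hypothesis hausT : hausdorff_space T.
Hypothesis openB : forall l, open (B l).
Hypothesis nbhsB : forall y (U : set T), nbhs y U -> exists2 l, B l y & B l `<=` U.
Hypothesis interB : forall k l, exists m, B m = B k `&` B l.
Hypothesis complB : forall l, exists m, B m = ~` B l.
Hypothesis satB : forall n l, exists m, B m = psat n l.

Lemma act_id y : act idfun y = y. Proof. by case: hact. Qed.

Lemma act_comp f g y : G f -> G g -> act (f \o g) y = act f (act g y).
Proof. by case: hact => _ H Gf Gg; rewrite H. Qed.

Lemma nbhs_basis l y : B l y -> nbhs y (B l).
Proof. by move=> ly; apply: open_nbhs_nbhs; split. Qed.

Lemma act_nbhs g l y : G g -> B l (act g y) ->
  exists2 k, B k y & forall z, B k z -> B l (act g z).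
Proof.
move=> Gg /nbhs_basis /(cact Gg) [n [V yV nV]].
by have [k ky kV] := nbhsB yV; exists k => // z /kV; exact: nV.
Qed.

Lemma act_inv g : G g -> exists g', [/\ G g', cancel g g', cancel g' g,
  forall y, act g (act g' y) = y & forall y, act g' (act g y) = y].
Proof.
move=> Gg; have [g' [Gg' gK g'K]] := group_inv hG Gg; exists g'; split=> // y.
  by rewrite -(act_comp _ Gg Gg'); have -> : g \o g' = idfun by [apply/funext => i; exact: g'K]; exact: act_id.
by rewrite -(act_comp _ Gg' Gg); have -> : g' \o g = idfun by [apply/funext => i; exact: gK]; exact: act_id.
Qed.

Lemma psat_id n l y : B l y -> psat n l y.
Proof. by move=> ly; exists idfun; [exact: pfix_id|rewrite act_id]. Qed.

Lemma psat_act n l v y : pfix G n v -> psat n l (act v y) <-> psat n l y.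
Proof.
move=> nv; split=> -[h nh hl].
  exists (h \o v); first exact: pfix_comp.
  by rewrite (act_comp _ nh.1 nv.1).
have [w [Gw vw wv Kw wK]] := act_inv nv.1.
have nw : pfix G n w by exact: pfix_inv nv Gw vw.
exists (h \o w); first exact: pfix_comp.
by rewrite (act_comp _ nh.1 Gw) wK.
Qed.

Definition ptype n y z := forall l, psat n l y <-> psat n l z.

(** The hypothesis says that [y] is in the closure of $V_nz$. One inclusion suffices because
    saturations and their complements are again basic. *)
Lemma ptypeP n y z : (forall l, B l y -> psat n l z) -> ptype n y z.
Proof.
move=> H l; split=> [ly|lz].
  have [k kE] := satB n l; have : psat n k z by apply: H; rewrite kE.
  by case=> v nv; rewrite kE => /(psat_act _ _ nv).
apply: contrapT => nly; have [k kE] := satB n l; have [m mE] := complB k.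
have [|v nv] := H m; first by rewrite mE kE.
by rewrite mE kE; apply; apply/(psat_act _ _ nv).
Qed.

Lemma ptype_sym n y z : ptype n y z -> ptype n z y.
Proof. by move=> H l; split=> /H. Qed.

Lemma ptype_trans n y z w : ptype n y z -> ptype n z w -> ptype n y w.
Proof. by move=> H K l; split=> [/H/K//|/K/H]. Qed.

Lemma ptype_fix n v y : pfix G n v -> ptype n (act v y) y.
Proof. by move=> nv l; exact: psat_act. Qed.

Lemma ptypeW m n y z : (m <= n)%N -> ptype n y z -> ptype m y z.
Proof.
move=> mn yz; apply: ptypeP => l ly.
have [h [Gh hn] hl] : psat n l z by apply/yz/psat_id.
by exists h => //; split=> //; apply: agreeW hn.
Qed.

(** The bound on [g] gives $gV_Ng^{-1}\subseteq V_n$, so [g] carries $N$-types to $n$-types. *)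
Lemma ptype_move g N n y z : G g -> (forall i, (g i < n)%N -> (i < N)%N) ->
  ptype N y z -> ptype n (act g y) (act g z).
Proof.
move=> Gg gN yz; apply: ptypeP => l /(act_nbhs Gg) [k ky kl].
have [v [Gv vN] kv] : psat N k z by apply/yz/psat_id.
have [g' [Gg' gg' g'g Kg gK]] := act_inv Gg.
have Gvg : G (v \o g') by exact: group_comp.
exists (g \o (v \o g')).
  split; first exact: group_comp.
  move=> i ni /=; rewrite vN; first exact: g'g.
  by apply: gN; rewrite g'g.
by rewrite (act_comp _ Gg Gvg) (act_comp _ Gv Gg') gK; exact: kl.
Qed.

Lemma ptype_act0 g y : G g -> ptype 0 (act g y) y.
Proof. by move=> Gg; apply: ptype_fix. Qed.

Variable x : T.

Definition piece : set T := [set y | ptype 0 x y].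

Lemma piece_x : piece x. Proof. by []. Qed.

Lemma piece_act g y : G g -> piece y -> piece (act g y).
Proof.
by move=> Gg xy; apply: ptype_trans xy _; apply: ptype_sym; exact: ptype_act0.
Qed.

Lemma piece_dense l y : piece y -> B l y -> exists2 g, G g & B l (act g x).
Proof. by move=> Cy /(psat_id 0) /Cy[h [Gh _] hl]; exists h. Qed.

(** The piece is closed: a difference in 0-type is witnessed by a saturation or its complement, and
    both are basic. *)
Lemma pieceN y : ~ piece y ->
  exists2 l, B l y & forall z, B l z -> ~ piece z.
Proof.
move=> nCy; have [l nl] : exists l, ~ (psat 0 l x <-> psat 0 l y).
  by apply: contrapT => /forallNP H; apply: nCy => l; exact: contrapT.
have [ly|nly] := pselect (psat 0 l y).
  have [k kE] := satB 0 l; exists k; first by rewrite kE.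
  by move=> z; rewrite kE => lz /(_ l) xz; apply: nl; split=> // _; exact/xz.
have [k kE] := satB 0 l; have [m mE] := complB k; exists m; first by rewrite mE kE.
by move=> z; rewrite mE kE => lz /(_ l) xz; apply: nl; split=> // /xz.
Qed.

(* Only points of Gx are tested, as these are the ones recorded by F_1; by density
   of Gx the property extends to C. *)
Definition isolating n l := forall g h, G g -> G h ->
  psat n l (act g x) -> psat n l (act h x) -> ptype n (act g x) (act h x).

(** If [B k] contained [y] but missed $V_nz$, then the basic sets $B_k\cap B_l$ and $B_l\setminus
    V_nB_k$ would both meet [piece], hence also $Gx$, giving two orbit points in [B l] with
    different $n$-types. *)
Lemma isolatingP n l y z : isolating n l -> piece y -> piece z ->
  B l y -> B l z -> ptype n y z.
Proof.
move=> nl Cy Cz ly lz; apply: ptypeP => k ky; apply: contrapT => nkz.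
have [m mE] := interB k l.
have [g Gg] : exists2 g, G g & B m (act g x).
  by apply: (piece_dense Cy); rewrite mE.
rewrite mE => -[kg lg].
have [a aE] := satB n k; have [b bE] := complB a; have [c cE] := interB b l.
have [h Gh] : exists2 h, G h & B c (act h x).
  by apply: (piece_dense Cz); rewrite cE bE aE.
rewrite cE bE aE => -[nkh lh]; apply: nkh.
by apply/(nl g h) => //; exact: psat_id.
Qed.

Definition atomic y := forall n, exists2 l, isolating n l & B l y.

(** A basic set disjoint from the piece isolates vacuously, as it meets no point of $Gx$. Thus the
    non-atomic points automatically lie in $C$. *)
Lemma atomic_out y : ~ piece y -> atomic y.
Proof.
move=> /pieceN [l ly lC] n; exists l => // g h Gg Gh [v [Gv _] vl] _.
by case: (lC _ vl); apply: piece_act => //; exact: piece_act.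
Qed.

(** An isolating set for the $N$-type of [y], with $g^{-1}\{0,\dots,n-1\}\subseteq\{0,\dots,N-1\}$,
    is transported by [g]; [ptype_move] then compares the $n$-types of the images. *)
Lemma atomic_act g y : G g -> atomic y -> atomic (act g y).
Proof.
move=> Gg ay n.
have [g' [Gg' gg' g'g Kg gK]] := act_inv Gg.
have [N NP] := bounded_below g' n.
have gN i : (g i < n)%N -> (i < N)%N by move/NP; rewrite gg'.
have [l Nl ly] := ay N.
have [k ky kl] : exists2 k, B k (act g y) & forall z, B k z -> B l (act g' z).
  by apply: act_nbhs => //; rewrite gK.
exists k => // h1 h2 Gh1 Gh2.
have aux h : G h -> psat n k (act h x) -> exists v,
    [/\ pfix G n v, G (g' \o (v \o h)) & psat N l (act (g' \o (v \o h)) x)].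
  move=> Gh [v nv kv]; have Gvh := group_comp hG nv.1 Gh.
  exists v; split=> //; first exact: group_comp.
  by apply: psat_id; rewrite (act_comp _ Gg' Gvh) (act_comp _ nv.1 Gh); exact: kl.
move=> /(aux _ Gh1)[v1 [nv1 G1 l1]] /(aux _ Gh2)[v2 [nv2 G2 l2]].
have := ptype_move Gg gN (Nl _ _ G1 G2 l1 l2).
have [Gv1 Gv2] := (group_comp hG nv1.1 Gh1, group_comp hG nv2.1 Gh2).
rewrite (act_comp _ Gg' Gv1) (act_comp _ Gg' Gv2) !Kg.
rewrite (act_comp _ nv1.1 Gh1) (act_comp _ nv2.1 Gh2).
move=> H; apply: ptype_trans (ptype_sym (ptype_fix _ nv1)) _.
by apply: ptype_trans H _; exact: ptype_fix.
Qed.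

(** The extension step of the back-and-forth: equality of $n$-types lets $V_nz$ reach the basic set
    that isolates the $m$-type of [y]. *)
Lemma atomic_step n m y z : atomic y -> piece y -> piece z -> ptype n y z ->
  exists2 v, pfix G n v & ptype m y (act v z).
Proof.
move=> ay Cy Cz yz; have [l ml ly] := ay m.
have [v nv vl] : psat n l z by apply/yz/psat_id.
exists v => //; apply: isolatingP ml _ _ _ vl => //.
by apply: piece_act => //; case: nv.
Qed.

Lemma basis_sep y z : (forall l, B l y -> ~ B l z -> False) -> y = z.
Proof.
move=> H; apply: hausT => U V /nbhsB[l ly lU] zV.
exists z; split; last exact: nbhs_singleton.
by apply: lU; apply: contrapT => /(H _ ly).
Qed.

(** The back-and-forth builds sequences [u], [w] in $G$ such that [u y] and [w x] have the same
    $n$-type for growing [n]; in the limit the two points coincide. *)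
Lemma atomic_orbit y : piece y -> atomic y -> atomic x ->
  exists2 g, G g & y = act g x.
Proof.
move=> Cy ay ax.
pose P k (s : (baire * baire) * nat) := [/\ G s.1.1, G s.1.2,
  ptype s.2 (act s.1.1 y) (act s.1.2 x), (k <= s.2)%N &
  forall i, (i < k)%N -> (s.1.1 i < s.2)%N /\ (s.1.2 i < s.2)%N].
have step (p : nat * ((baire * baire) * nat)) : exists s', P p.1 p.2 ->
   P p.1.+1 s' /\ [/\ agree p.1 s'.1.1 p.2.1.1, agree p.1 s'.1.2 p.2.1.2,
   forall i, (p.2.1.1 i < p.1)%N -> s'.1.1 i = p.2.1.1 i &
   forall i, (p.2.1.2 i < p.1)%N -> s'.1.2 i = p.2.1.2 i].
  case: p => k [[u w] n] /=.
  have [|nP] := pselect (P k (u, w, n)); last by exists (u, w, n) => /nP.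
  case=> /= Gu Gw uw kn bnd.
  (* First the side of [x] is moved by [v1], using that [y] is atomic, then the side of [y] by [v2],
     using that [x] is. Taking [M1] above the first [k.+1] values of [u] makes [v2] preserve these
     values. *)
  have [M1 M1P] := bounded_below u k.+1.
  have [v1 nv1 e1] : exists2 v, pfix G n v &
      ptype (maxn n M1) (act u y) (act v (act w x)).
    by apply: atomic_step => //; [exact: atomic_act|exact: piece_act|exact: piece_act].
  have Gv1 := nv1.1; have Gw1 : G (v1 \o w) by exact: group_comp.
  have [M2 M2P] := bounded_below (v1 \o w) k.+1.
  have [v2 nv2 e2] : exists2 v, pfix G (maxn n M1) v &
      ptype (maxn k.+1 (maxn (maxn n M1) M2)) (act (v1 \o w) x) (act v (act u y)).
    apply: atomic_step; [exact: atomic_act|exact: piece_act|exact: piece_act|].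
    by rewrite (act_comp _ Gv1 Gw); exact: ptype_sym.
  have Gv2 := nv2.1.
  exists (v2 \o u, v1 \o w, maxn k.+1 (maxn (maxn n M1) M2)) => _.
  have fix2 j : (j < n)%N -> v2 j = j.
    by move=> jn; apply: nv2.2; rewrite leq_max jn.
  have uM i : (i < k.+1)%N -> v2 (u i) = u i.
    by move=> ik; apply: nv2.2; rewrite leq_max M1P ?orbT.
  split; split=> /=.
  - exact: group_comp.
  - exact: Gw1.
  - by apply: ptype_sym; rewrite (act_comp _ Gv2 Gu).
  - by rewrite leq_maxl.
  - move=> i ik; rewrite uM //; split.
      by rewrite !leq_max M1P ?orbT.
    by rewrite !leq_max (M2P i ik) !orbT.
  - by move=> i ik /=; rewrite uM // ltnS ltnW.
  - by move=> i ik /=; apply: nv1.2; case: (bnd i ik).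
  - by move=> i ik /=; rewrite fix2 // (leq_trans ik).
  - by move=> i ik /=; apply: nv1.2; rewrite (leq_trans ik).
(* The bounds in [P] freeze u and w below k, so both sequences converge in G. *)
have [nxt nxtP] := choice step.
pose s := fix s k := if k is k'.+1 then nxt (k', s k') else ((idfun : baire, idfun : baire), 0%N).
have sP k : P k (s k).
  elim: k => [|k /(nxtP (k, s k))[]//]; split=> //=; try exact: group_id.
  by rewrite !act_id; exact: ptype_sym.
have sN k := (nxtP (k, s k) (sP k)).2.
have [u Gu uE] : exists2 u, G u & forall k, agree k u (s k).1.1.
  apply: group_lim => // k; first by case: (sP k).
    by case: (sN k).
  by case: (sN k).
have [w Gw wE] : exists2 w, G w & forall k, agree k w (s k).1.2.
  apply: group_lim => // k; first by case: (sP k).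
    by case: (sN k).
  by case: (sN k).
have uwE : act u y = act w x.
  apply: basis_sep => l lu nlw.
  have [m mE] := complB l.
  have [n1 [V1 yV1 V1P]] := cact Gu (nbhs_basis lu).
  have mw : B m (act w x) by rewrite mE.
  have [n2 [V2 xV2 V2P]] := cact Gw (nbhs_basis mw).
  pose k := maxn n1 n2; have [Gk1 Gk2 ek nk bk] := sP k.
  have lk : B l (act (s k).1.1 y).
    apply: V1P => //; last exact: nbhs_singleton.
    by apply: agree_sym; apply: agreeW (uE k); rewrite leq_maxl.
  have [v nv] : psat (s k).2 l (act (s k).1.2 x) by apply/ek/psat_id.
  have Gv := nv.1.
  rewrite -(act_comp _ Gv Gk2) => lv.
  (* The element [v] fixes everything below the type bound, hence the first [k] values of [w]. So
     [v] composed with the stage of [w] is still close to the limit [w], and continuity puts the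
     image of [x] into the complement of [B l]. *)
  have : B m (act (v \o (s k).1.2) x).
    apply: V2P; [exact: group_comp| |exact: nbhs_singleton].
    move=> i i2; have ik : (i < k)%N by rewrite (leq_trans i2) // leq_maxr.
    by rewrite (wE k i ik) /= nv.2 //; case: (bk i ik).
  by rewrite mE.
have [u' [Gu' _ _ Ku uK]] := act_inv Gu.
by exists (u' \o w); [exact: group_comp|rewrite (act_comp _ Gu' Gw) -uwE uK].
Qed.


(** The closure of the points $hx$ with [h] in $G$ agreeing with [s] below [n]. If such an [h]
    exists this is a translate of the closure of $V_nx$, otherwise it is empty. *)
Definition coset_closure n (s : nat -> nat) : set T :=
  [set y | forall l, B l y -> exists h, [/\ G h, agree n h s & B l (act h x)]].

Lemma coset_closureP n s y h0 h' : G h0 -> agree n h0 s -> G h' ->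
  cancel h0 h' -> coset_closure n s y -> ptype n (act h' y) x.
Proof.
move=> Gh0 h0s Gh' h0K sy; apply: ptypeP => l /(act_nbhs Gh') [k ky kl].
have [h [Gh hs kh]] := sy k ky; exists (h' \o h).
  by split; [exact: group_comp|move=> i ni /=; rewrite hs // -h0s // h0K].
by rewrite (act_comp _ Gh' Gh); exact: kl.
Qed.

Lemma coset_closure_ptype n y g h : G g -> G h -> cancel h g ->
  (forall y, act h (act g y) = y) ->
  ptype n (act g y) x -> coset_closure n h y.
Proof.
move=> Gg Gh hK gK yx l ly.
have [k ky kl] : exists2 k, B k (act g y) & forall z, B k z -> B l (act h z).
  by apply: act_nbhs => //; rewrite gK.
have [v [Gv vn] kv] : psat n k x by apply/yx/psat_id.
exists (h \o v); split; first exact: group_comp.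
  by move=> i ni; rewrite /= vn.
by rewrite (act_comp _ Gh Gv); exact: kl.
Qed.

(** If such a closure contained a nonempty relatively open part of $C$, an element [h] of the coset
    would pull that part back to a basic neighbourhood of [x] in which all points of $Gx$ have the
    $n$-type of [x]; this neighbourhood would isolate it. *)
Lemma coset_closure_nowhere_dense n s l :
  ~ (exists2 l, isolating n l & B l x) -> B l `&` piece !=set0 ->
  exists y, [/\ B l y, piece y & ~ coset_closure n s y].
Proof.
move=> nat_n [z [lz Cz]]; apply: contrapT => nex.
have all_in y : B l y -> piece y -> coset_closure n s y.
  by move=> ly Cy; apply: contrapT => ny; apply: nex; exists y.
have [h [Gh hs lh]] := all_in z lz Cz l lz.
have [h' [Gh' hK h'K Kh Kh']] := act_inv Gh.
have [k kx kl] := act_nbhs Gh lh.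
apply: nat_n; exists k => //.
have aux g : G g -> psat n k (act g x) -> ptype n (act g x) x.
  move=> Gg [v nv kv]; apply: ptype_trans (ptype_sym (ptype_fix _ nv)) _.
  rewrite -[act v _]Kh'; apply: (coset_closureP Gh hs Gh' hK).
  by apply: all_in; [exact: kl|apply: piece_act Gh _; apply: piece_act nv.1 _; exact: piece_act].
move=> g1 g2 Gg1 Gg2 p1 p2; apply: ptype_trans (aux _ Gg1 p1) _.
exact: ptype_sym (aux _ Gg2 p2).
Qed.

(** A point whose orbit realizes the $n$-type of [x] lies in a coset closure, determined by the
    first [n] values of a permutation. Finite sequences enumerate these closures, and the Baire
    category theorem gives a point of $C$ outside all of them. *)
Lemma nonatomic (R : realType) : polish R T -> ~ atomic x ->
  exists n, exists2 y, piece y & forall g, G g -> ~ ptype n (act g y) x.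
Proof.
move=> polT /existsNP[n nat_n]; exists n.
pose E j : set T := if choice.unpickle j is Datatypes.Some s then coset_closure n (nth 0%N s) else set0.
have clB l : closed (B l).
  have [m mE] := complB l; rewrite -[B l]setCK -mE; exact/open_closedC.
have [y Cy nEy] : exists2 y, piece y & forall j, ~ E j y.
  apply: (@polish_baire R T nat B piece E) => //.
  - rewrite -[piece]setCK; apply: open_closedC; rewrite openE => y /pieceN[l ly lC].
    by apply: filterS (nbhs_basis ly) => z /lC.
  - by exists x.
  - move=> j l lC; rewrite /E; case: (choice.unpickle j) => [s|]; last first.
      by case: lC => z [lz Cz]; exists l; [exists z|rewrite setI0].
    have [y [ly Cy /existsNP[k /not_implyP[ky kn]]]] :=
      coset_closure_nowhere_dense (nth 0%N s) nat_n lC.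
    exists k; first by exists y.
    by rewrite -subset0 => z [kz /(_ k kz)]; exact: kn.
  - by move=> l z; exact: nbhs_basis.
exists y => // g Gg yx; have [h [Gh gK hK _ Kg]] := act_inv Gg.
apply: (nEy (choice.pickle (mkseq h n))); rewrite /E choice.pickleK.
move=> l ly; have [v [Gv vh lv]] := coset_closure_ptype Gg Gh hK Kg yx ly.
by exists v; split=> // i ni; rewrite vh // nth_mkseq.
Qed.

(** For fixed [m] the maps from {0, ..., n-1} to {0, ..., m-1} are finitely many, so the closure of
    the union of their cosets is the union of the coset closures. Hence one numerical bound can
    replace the finite map. *)
Lemma bounded_closureP n y :
  (exists2 g, G g & ptype n (act g y) x) <->
  (exists m, forall l, B l y -> exists h,
    [/\ G h, forall i, (i < n)%N -> (h i < m)%N & B l (act h x)]).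
Proof.
split=> [[g Gg yx]|[m my]].
  have [h [Gh gK hK _ Kg]] := act_inv Gg.
  have [m mP] := bounded_below h n; exists m => l ly.
  have [v [Gv vh lv]] := coset_closure_ptype Gg Gh hK Kg yx ly.
  by exists v; split=> // i ni; rewrite vh // mP.
(* The value 0 outside the domain is arbitrary: only arguments below [n] are compared. *)
pose s (f : {ffun 'I_n -> 'I_m}) i := if insub i is Datatypes.Some j then val (f j) else 0%N.
have [[f fy]|nf] := pselect (exists f, coset_closure n (s f) y).
  have [l0 l0y _] := nbhsB (@filterT _ (nbhs y) _).
  have [h [Gh hs _]] := fy l0 l0y.
  have [h' [Gh' hK h'K Kh Kh']] := act_inv Gh.
  by exists h' => //; exact: coset_closureP Gh hs Gh' hK fy.
have /choice[l lP] : forall f, exists l, B l y /\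
    forall h, G h -> agree n h (s f) -> ~ B l (act h x).
  move=> f; apply: contrapT => nl; apply: nf; exists f => l ly.
  apply: contrapT => nh; apply: nl; exists l; split=> // h Gh hs lh.
  by apply: nh; exists h.
have : nbhs y [set z | forall f, B (l f) z].
  by apply: filter_forall => f; apply: nbhs_basis; case: (lP f).
move=> /nbhsB[k ky kl]; have [h [Gh hm kh]] := my k ky.
pose f := [ffun j : 'I_n => Ordinal (hm j (ltn_ord j))].
case: (lP f) => _ /(_ h Gh); case; last exact: kl.
by move=> i ni; rewrite /s insubT ffunE.
Qed.
End Dynamics.

(** * Vaught transforms and the saturations of a nice basis *)

Lemma continuous_action_nbhs (G : set baire) (T : topologicalType)
    (act : baire -> T -> T) : continuous_action G act ->
  forall g y (U : set T), G g -> nbhs (act g y) U ->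
  exists n, exists2 V, nbhs y V &
    forall h z, G h -> agree n h g -> V z -> U (act h z).
Proof.
move=> cA g y U Gg gyU.
have Ap : (G `*` [set: T]) (g, y) by [].
have := cA (g, y) U gyU; rewrite /= nbhs_simpl /= => H.
have {}H : within (G `*` [set: T]) (nbhs (g, y)) [set p | U (act p.1 p.2)].
  by rewrite nbhs_subspace_in.
case: H => -[P Q] /= [/nbhs_agreeP[n nP] yQ] PQ.
by exists n, Q => // h z Gh hg Qz; apply: (PQ (h, z)); split=> //; exact: nP.
Qed.

Lemma polish_hausdorff (R : realType) (T : topologicalType) :
  polish R T -> hausdorff_space T.
Proof.
move=> [_ [M [f [g [fgK gfK cf cg _]]]]] p q pq.
rewrite -[p]fgK -[q]fgK; congr (g _); apply: (@metric_hausdorff R M) => U V pU qV.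
by have [z [Uz Vz]] := pq _ _ (cf p _ pU) (cf q _ qV); exists (f z).
Qed.

Lemma meagre0 (T : topologicalType) : meagre (@set0 T).
Proof.
exists (fun=> set0); split=> [_|]; last by rewrite bigcup0.
by rewrite /nowhere_dense closure0 interior0.
Qed.

Section NiceBasis.
Variables (G : set baire) (hG : closed_subgroup G) (X : topologicalType).
Variables (act : baire -> X -> X) (hact : is_action G act).
Variables (t : Topological X) (B : nat -> set X).
Hypothesis cact : @continuous_action G (Defs.space t) act.
Hypothesis niceB : nice_basis G act t (range B).

Lemma pfix_Nfam n : Nfam G (pfix G n).
Proof.
exists (fres idfun [fset i | i in iota 0 n]%fset).
  by exists idfun; [exact: group_id|exists [fset i | i in iota 0 n]%fset].
have in_d i : (i \in [fset i | i in iota 0 n]%fset) = (i < n)%N.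
  by rewrite !inE /= mem_iota.
apply/seteqP; split=> f [Gf fn]; split=> //.
  by move=> i ni; rewrite -in_d in ni; have := fn [` ni]%fset; rewrite ffunE.
by case=> i id; rewrite ffunE /= fn // -in_d.
Qed.

Lemma nice_open l : @open (Defs.space t) (B l).
Proof. by case: niceB => -[[Bo _] _] _ _ _ _; apply: Bo; exists l. Qed.

Lemma nice_nbhs (y : Defs.space t) (U : set (Defs.space t)) :
  nbhs y U -> exists2 l, B l y & B l `<=` U.
Proof.
case: niceB => -[[_ Bb] _] _ _ _ _ /Bb[_ [[l _ <-] ly] lU].
by exists l.
Qed.

Lemma nice_inter k l : exists m, B m = B k `&` B l.
Proof.
case: niceB => _ H _ _ _.
by have [||m _ mE] := H (B k) (B l); [exists k|exists l|exists m].
Qed.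

Lemma nice_compl l : exists m, B m = ~` B l.
Proof. by case: niceB => _ _ H _ _; have [|m _ mE] := H (B l); [exists l|exists m]. Qed.

(** If some [h] in $V_n$ brings [y] into the open set [B l], so does a whole neighbourhood of [h],
    which is non-meagre by [meagre_pfix]. This duality makes $V_nB_l$ the complement of a Vaught
    transform, hence basic. *)
Lemma vaught_complement n l : vaught act (~` B l) (pfix G n) = ~` psat G act B n l.
Proof.
apply/seteqP; split=> y.
  move=> co [h nh lh]; move: co; rewrite /vaught /= /comeagre_in /comeagre => co.
  have hin : nbhs (act h y : Defs.space t) (B l) by apply: open_nbhs_nbhs; split=> //; exact: nice_open.
  have [m [V yV mV]] := continuous_action_nbhs cact nh.1 hin.
  have [h' h'm nA] := meagre_pfix hG (SigSub (mem_set nh)) m co.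
  apply: nA => /=; apply; apply: mV; [|exact: h'm|exact: (nbhs_singleton yV)].
  by have [] : pfix G n (set_val h') by exact: set_valP.
move=> ny; rewrite /vaught /= /comeagre_in /comeagre.
set A := (X in meagre X); suff -> : A = set0 by exact: meagre0.
rewrite -subset0 => h /= nh; apply: nh => lh; apply: ny.
by exists (set_val h) => //; exact: set_valP.
Qed.

Lemma nice_sat n l : exists m, B m = psat G act B n l.
Proof.
have [k kE] := nice_compl l.
have [m _ mE] : range B (vaught act (B k) (pfix G n)).
  by case: niceB => _ _ _ H _; apply: H; [exists k|exact: pfix_Nfam].
have [p pE] := nice_compl m.
by exists p; rewrite pE mE kE vaught_complement setCK.
Qed.

Lemma setact_psat l y : setact act G (B l) y <-> psat G act B 0 l y.
Proof.
split=> [[h Gh [z lz <-]]|[h [Gh _] lh]].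
  have [h' [Gh' hK h'K Kh Kh']] := act_inv hG hact Gh.
  by exists h' => //; rewrite Kh'.
have [h' [Gh' hK h'K Kh Kh']] := act_inv hG hact Gh.
by exists h' => //; exists (act h y) => //; rewrite Kh'.
Qed.

(** Since $V_0=G$, the 0-type of a point lists exactly the sets $GB_l$ that contain it. *)
Lemma canonical_pieceE x : canonical_piece G act (range B) x = @piece G X act B x.
Proof.
apply/seteqP; split=> y.
  move=> [yin yout] l; split=> [lx|ly]; apply/setact_psat.
    by apply: yin; split; [exists l|exact/setact_psat].
  apply: contrapT => nlx; have := yout (B l); apply.
    by split; first by exists l.
  exact/setact_psat.
move=> Cy; split=> _ [[l _ <-] lx]; [|apply: contra_not lx] => /=;
  rewrite !setact_psat; move/(_ l): Cy; [move=> <-|move=> ->] => //.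
exact/setact_psat.
Qed.

End NiceBasis.

(** * Delta_0 definability *)

Section Definability.
Variables (L : language) (A : structure L).

(** A context relates environments to tuples of values. By [assigns_agree] only the variables below
    [width] matter, so the variable numbered [width] is fresh for the next quantifier. *)
Record ctx := Ctx {
  carrier : Type;
  width : nat;
  assigns : (nat -> elt A) -> carrier -> Prop;
  assigns_agree : forall e e' s, (forall i, (i < width)%N -> e i = e' i) ->
    assigns e s -> assigns e' s }.

Definition isvar (K : ctx) (u : carrier K -> elt A) :=
  exists i, forall e s, assigns e s -> e i = u s.

Definition dfn (K : ctx) (P : carrier K -> Prop) :=
  exists2 p : formula L, is_delta0 p & forall e s, assigns e s -> (sat e p <-> P s).

Definition ctx_ext (K : ctx) : ctx.
Proof.
refine (@Ctx (carrier K * elt A) (width K).+1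
  (fun e s => assigns e s.1 /\ e (width K) = s.2) _).
abstract (by move=> e e' s ee' [es <-]; split; [apply: assigns_agree es => i iw; apply: ee'; rewrite ltnW | rewrite ee']).
Defined.

Lemma assigns_upd (K : ctx) e (s : carrier K) v : assigns e s ->
  @assigns (ctx_ext K) (upd e (width K) v) (s, v).
Proof.
move=> es; split=> /=; last by rewrite /upd eqxx.
by apply: assigns_agree es => i iw; rewrite /upd ltn_eqF.
Qed.

Lemma isvar_lift (K : ctx) u : isvar u -> @isvar (ctx_ext K) (fun s => u s.1).
Proof. by move=> [i iP]; exists i => e s [/iP]. Qed.

Lemma isvar_new (K : ctx) : @isvar (ctx_ext K) (fun s => s.2).
Proof. by exists (width K) => e s []. Qed.

Lemma dfn_ext (K : ctx) (P Q : carrier K -> Prop) :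
  dfn P -> (forall s, P s <-> Q s) -> dfn Q.
Proof. by move=> [p dp pP] PQ; exists p => // e s es; rewrite (pP _ _ es). Qed.

Lemma dfn_in (K : ctx) (u v : carrier K -> elt A) :
  isvar u -> isvar v -> dfn (fun s => isin (u s) (v s)).
Proof.
move=> [i iP] [j jP]; exists (FIn (Var L i) (Var L j)) => //= e s es.
by rewrite (iP _ _ es) (jP _ _ es).
Qed.

Lemma dfn_eq (K : ctx) (u v : carrier K -> elt A) :
  isvar u -> isvar v -> dfn (fun s => u s = v s).
Proof.
move=> [i iP] [j jP]; exists (FEq (Var L i) (Var L j)) => //= e s es.
by rewrite (iP _ _ es) (jP _ _ es).
Qed.

Lemma dfn_set (K : ctx) (u : carrier K -> elt A) :
  isvar u -> dfn (fun s => is_set (u s)).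
Proof. by move=> [i iP]; exists (FIsSet (Var L i)) => //= e s es; rewrite (iP _ _ es). Qed.

Lemma dfn_not (K : ctx) (P : carrier K -> Prop) : dfn P -> dfn (fun s => ~ P s).
Proof. by move=> [p dp pP]; exists (FNot p) => //= e s es; rewrite (pP _ _ es). Qed.

Lemma dfn_and (K : ctx) (P Q : carrier K -> Prop) :
  dfn P -> dfn Q -> dfn (fun s => P s /\ Q s).
Proof.
move=> [p dp pP] [q dq qP]; exists (FAnd p q) => /= [|e s es]; first by rewrite dp.
by rewrite (pP _ _ es) (qP _ _ es).
Qed.

Lemma dfn_or (K : ctx) (P Q : carrier K -> Prop) :
  dfn P -> dfn Q -> dfn (fun s => P s \/ Q s).
Proof.
move=> [p dp pP] [q dq qP]; exists (FOr p q) => /= [|e s es]; first by rewrite dp.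
by rewrite (pP _ _ es) (qP _ _ es).
Qed.

Lemma dfn_imp (K : ctx) (P Q : carrier K -> Prop) :
  dfn P -> dfn Q -> dfn (fun s => P s -> Q s).
Proof.
move=> dP dQ; apply: dfn_ext (dfn_or (dfn_not dP) dQ) _ => s.
by split=> [[]//|PQ]; have [/PQ|] := pselect (P s); [right|left].
Qed.

(* The new variable is bound through an arbitrary extension [K'] of the context,
   so that goals never mention variable numbers. *)
Definition dfn_bound (K : ctx) (Q : carrier K -> elt A -> Prop) :=
  forall (K' : ctx) (f : carrier K' -> carrier K) (v : carrier K' -> elt A),
    (forall u, isvar u -> isvar (fun s => u (f s))) -> isvar v ->
    dfn (fun s => Q (f s) (v s)).

Lemma dfn_bex (K : ctx) (u : carrier K -> elt A) Q : isvar u -> dfn_bound Q ->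
  dfn (fun s => exists2 v, isin v (u s) & Q s v).
Proof.
move=> [i iP] /(_ (ctx_ext K) fst snd (@isvar_lift K) (isvar_new K))[p dp pP].
exists (FBEx (width K) i p) => //= e s es; rewrite (iP _ _ es).
have H v := pP _ _ (assigns_upd v es).
by split=> -[v vu vQ]; exists v => //; apply/H.
Qed.

Lemma dfn_ball (K : ctx) (u : carrier K -> elt A) Q : isvar u -> dfn_bound Q ->
  dfn (fun s => forall v, isin v (u s) -> Q s v).
Proof.
move=> [i iP] /(_ (ctx_ext K) fst snd (@isvar_lift K) (isvar_new K))[p dp pP].
exists (FBAll (width K) i p) => //= e s es; rewrite (iP _ _ es).
have H v := pP _ _ (assigns_upd v es).
by split=> vQ v /vQ/H.
Qed.

End Definability.

(** Under a new bounded quantifier the context changes, and every known variable has to be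
    transported to the extended one. *)
Ltac dfn_lift l :=
  repeat match goal with
  | H : isvar _ |- _ => apply l in H; cbv beta in H
  end.

Ltac dfn_intro :=
  let K := fresh "K" in let f := fresh "f" in let v := fresh "v" in
  let l := fresh "l" in let vP := fresh "vP" in
  move=> K f v l; dfn_lift l; clear l; move=> vP; cbv beta.

Ltac dfn_step := cbv beta; first
 [ assumption
 | apply: dfn_and | apply: dfn_or | apply: dfn_not
 | apply: dfn_in; [assumption|assumption] | apply: dfn_eq; [assumption|assumption]
 | apply: dfn_set; assumption
 | apply: dfn_bex; [assumption|dfn_intro]
 | apply: dfn_ball; [assumption|dfn_intro]
 | apply: dfn_imp ].

Section Pairs.
Variables (L : language) (A : structure L).

(** This form bounds the singleton and the doubleton by the pair itself and is therefore
    $\Delta_0$. *)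
Lemma is_pairE (z v w : elt A) : is_pair z v w <->
  exists2 s, isin s z & exists2 d, isin d z &
    (isin v s /\ (forall y, isin y s -> y = v)) /\
    ((isin v d /\ isin w d /\ (forall y, isin y d -> y = v \/ y = w)) /\
    (forall y, isin y z -> y = s \/ y = d)).
Proof.
split=> [[s [d [[a -> aP] [b -> bP] [c -> cP]]]]|].
  exists (inr a); first by apply/cP; left.
  exists (inr b); first by apply/cP; right.
  split; first by split=> [|y]; [exact/aP|move/aP].
  split; last by move=> y /cP.
  by split; [apply/bP; left|split; [apply/bP; right|move=> y /bP]].
move=> [s sz [d dz [[vs sP] [[vd [wd dP]] zP]]]]; exists s, d; split.
- by case: s vs sP {sz zP} => // a va sP; exists a => // y; split=> [/sP|->].
- by case: d vd wd dP {dz zP} => // a va wa aP; exists a => // y; split=> [/aP|[]->].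
- by case: z sz dz zP => // a sa da aP; exists a => // y; split=> [/aP|[]->].
Qed.

Lemma dfn_pair (K : ctx A) (z v w : carrier K -> elt A) :
  isvar z -> isvar v -> isvar w -> dfn (fun s => is_pair (z s) (v s) (w s)).
Proof.
move=> zP vP wP; apply: dfn_ext; last by move=> s; symmetry; exact: is_pairE.
by repeat dfn_step.
Qed.

(** The components of a Kuratowski pair are members of its members, so these two quantifiers are in
    effect bounded. *)
Lemma dfn_expair (K : ctx A) (z : carrier K -> elt A)
    (Q : carrier K -> elt A -> elt A -> Prop) : isvar z ->
  (forall (K' : ctx A) (f : carrier K' -> carrier K) (v w : carrier K' -> elt A),
    (forall u, isvar u -> isvar (fun s => u (f s))) -> isvar v -> isvar w ->
    dfn (fun s => Q (f s) (v s) (w s))) ->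
  dfn (fun s => exists v w, is_pair (z s) v w /\ Q s v w).
Proof.
move=> zP QP.
have H : dfn (fun s => exists2 d, isin d (z s) & exists2 d', isin d' (z s) &
   exists2 v, isin v d & exists2 w, isin w d' & is_pair (z s) v w /\ Q s v w).
  apply: dfn_bex => // K1 f1 v1 l1 vP1; apply: dfn_bex => [|K2 f2 v2 l2 vP2]; first exact: l1.
  apply: dfn_bex => [|K3 f3 v3 l3 vP3]; first exact: (l2 _ vP1).
  apply: dfn_bex => [|K4 f4 v4 l4 vP4]; first exact: (l3 _ vP2).
  apply: dfn_and.
    apply: dfn_pair => //; last exact: (l4 _ vP3).
    exact: (l4 _ (l3 _ (l2 _ (l1 _ zP)))).
  apply: (QP K4 (fun s => f1 (f2 (f3 (f4 s))))) => // [u uP|]; last exact: (l4 _ vP3).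
  exact: (l4 _ (l3 _ (l2 _ (l1 _ uP)))).
apply: dfn_ext H _ => s; split.
  by move=> [d _ [d' _ [v _ [w _ vw]]]]; exists v, w.
move=> [v [w [/[dup] vw]]] /is_pairE[a az [d dz [[va _] [[_ [wd _]] _]]]] Qvw.
by exists a => //; exists d => //; exists v => //; exists w.
Qed.

End Pairs.

Ltac dfn_intro2 :=
  let K := fresh "K" in let f := fresh "f" in
  let v := fresh "v" in let w := fresh "w" in
  let l := fresh "l" in let vP := fresh "vP" in let wP := fresh "wP" in
  move=> K f v w l; dfn_lift l; clear l; move=> vP wP; cbv beta.

Ltac dfn_auto := repeat first
 [ progress cbv beta
 | apply: dfn_pair; [assumption|assumption|assumption]
 | apply: dfn_expair; [assumption|dfn_intro2]
 | dfn_step ].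

(** * Sets in a model of KPU *)

Section KPUTheory.
Variables (L : language) (A : structure L) (kpu : KPU A).

(** Quantifying over all contexts in which the parameters [ps] are variables lets definitions be
    substituted under quantifiers. *)
Definition definable1 (ps : seq (elt A)) (P : elt A -> Prop) :=
  forall K : ctx A, (forall c, List.In c ps -> isvar (fun _ : carrier K => c)) ->
  forall u : carrier K -> elt A, isvar u -> dfn (fun s => P (u s)).

Definition definable2 (ps : seq (elt A)) (P : elt A -> elt A -> Prop) :=
  forall K : ctx A, (forall c, List.In c ps -> isvar (fun _ : carrier K => c)) ->
  forall u v : carrier K -> elt A, isvar u -> isvar v -> dfn (fun s => P (u s) (v s)).

Definition base_ctx (ps : seq (elt A)) : ctx A.
Proof.
refine (@Ctx _ A unit (size ps) (fun e _ => forall i, (i < size ps)%N ->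
  e i = nth (inr (emp A)) ps i) _).
abstract (by move=> e e' s ee' es i ips; rewrite -ee' // es).
Defined.

Lemma base_isvar ps c : List.In c ps -> isvar (fun _ : carrier (base_ctx ps) => c).
Proof.
move=> cps; have [i ips <-] : exists2 i, (i < size ps)%N & nth (inr (emp A)) ps i = c.
  elim: ps cps => //= d ps IH [->|/IH[i ips ic]]; first by exists 0%N.
  by exists i.+1.
by exists i => e s; exact.
Qed.

Lemma separation ps P a : definable1 ps P ->
  exists b, forall v, smem v b <-> smem v a /\ P v.
Proof.
move=> dP; case: kpu => _ [_ _ sep _].
have [|p dp pP] := dP (ctx_ext (base_ctx ps)) _ snd (isvar_new _).
  by move=> c cps; exact: isvar_lift (base_isvar cps).
pose e := nth (inr (emp A)) ps.
have [b bP] := sep p e (size ps) a dp; exists b => v; rewrite bP.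
rewrite (pP (upd e (size ps) v) (tt, v)) //.
exact: (@assigns_upd _ _ (base_ctx ps) e tt v).
Qed.

Lemma collection ps Q a : definable2 ps Q ->
  (forall v, smem v a -> exists w, Q v w) ->
  exists b, forall v, smem v a -> exists2 w, smem w b & Q v w.
Proof.
move=> dQ; case: kpu => _ [_ _ _ col].
have [||p dp pP] := dQ (ctx_ext (ctx_ext (base_ctx ps))) _ (fun s => s.1.2) snd _ (isvar_new _).
- by move=> c cps; exact: isvar_lift (isvar_lift (base_isvar cps)).
- exact: (@isvar_lift _ _ (ctx_ext (base_ctx ps)) snd (isvar_new _)).
pose e := nth (inr (emp A)) ps.
have eP v w : sat (upd (upd e (size ps) v) (size ps).+1 w) p <-> Q v w.
  rewrite (pP _ (tt, v, w)) //.
  apply: (@assigns_upd _ _ (ctx_ext (base_ctx ps)) _ (tt, v) w).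
  exact: (@assigns_upd _ _ (base_ctx ps) e tt v).
move=> aQ; have [|b bP] := col p e (size ps) (size ps).+1 a dp.
  by move=> v /aQ[w vw]; exists w; exact/eP.
by exists b => v /bP[w wb /eP vw]; exists w.
Qed.

Lemma is_ext_uniq (z z' : elt A) P : is_ext z P -> is_ext z' P -> z = z'.
Proof.
move=> [a -> aP] [b -> bP]; case: kpu => -[ext _ _] _.
by congr inr; apply: ext => v; rewrite aP bP.
Qed.

Lemma is_ext_iff (z : elt A) P Q : (forall v, P v <-> Q v) -> is_ext z P -> is_ext z Q.
Proof. by move=> PQ [a -> aP]; exists a => // v; rewrite aP. Qed.

Lemma is_extE (z : elt A) P v : is_ext z P -> isin v z <-> P v.
Proof. by move=> [a -> aP]; exact: aP. Qed.

Lemma ext_zero : is_ext (inr (emp A)) (fun _ => False).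
Proof. by exists (emp A) => // v; split=> //; case: kpu => -[_ H _] _; exact: H. Qed.

Lemma unordered_pair (v w : elt A) : exists z, is_ext z (fun y => y = v \/ y = w).
Proof.
case: (kpu) => _ [pr _ _ _]; have [a [va wa]] := pr v w.
have d : definable1 [:: v; w] (fun y => y = v \/ y = w).
  move=> K Kps u uP.
  have vP := Kps v (or_introl erefl); have wP := Kps w (or_intror (or_introl erefl)).
  by dfn_auto.
have [b bP] := separation a d; exists (inr b), b => // y.
by rewrite bP; split=> [[]//|]; case=> ->; split=> //; [left|right].
Qed.

Lemma pair_exists (v w : elt A) : exists q, is_pair q v w.
Proof.
have [s sP] := unordered_pair v v; have [d dP] := unordered_pair v w.
have [q qP] := unordered_pair s d; exists q, s, d; split=> //.
by apply: is_ext_iff sP => y; split=> [[]|]//; left.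
Qed.

Lemma pair_uniq (q q' v w : elt A) : is_pair q v w -> is_pair q' v w -> q = q'.
Proof.
move=> [s [d [sP dP qP]]] [s' [d' [sP' dP' qP']]].
move: qP'; rewrite -(is_ext_uniq sP sP') -(is_ext_uniq dP dP'); exact: is_ext_uniq.
Qed.

Lemma pair_inj (q v w v' w' : elt A) : is_pair q v w -> is_pair q v' w' ->
  v = v' /\ w = w'.
Proof.
move=> [s [d [sP dP qP]]] [s' [d' [sP' dP' qP']]].
have vv : v = v'.
  have /(is_extE _ qP)[e|e] : isin s' q by apply/(is_extE _ qP'); left.
    by move: sP'; rewrite e => sP'; apply/(is_extE _ sP'); exact/(is_extE _ sP).
  have : isin v d by apply/(is_extE _ dP); left.
  by rewrite -e => /(is_extE _ sP').
split=> //; subst v'.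
have ss : s = s' by exact: is_ext_uniq sP sP'.
subst s'.
have sd : is_ext s (fun y => y = v \/ y = v).
  by apply: is_ext_iff sP => y; split=> [|[]]//; left.
have /(is_extE _ qP)[e|e] : isin d' q by apply/(is_extE _ qP'); right.
  have w'v : w' = v.
    have : isin w' d' by apply/(is_extE _ dP'); right.
    by rewrite e => /(is_extE _ sP).
  have /(is_extE _ qP')[e'|e'] : isin d q by apply/(is_extE _ qP); right.
    have : isin w d by apply/(is_extE _ dP); right.
    by rewrite e' => /(is_extE _ sP); rewrite w'v.
  have : isin w d by apply/(is_extE _ dP); right.
  by rewrite e' e => /(is_extE _ sP); rewrite w'v.
have : isin w' d by rewrite -e; apply/(is_extE _ dP'); right.
case/(is_extE _ dP) => // w'v.
have : isin w d by apply/(is_extE _ dP); right.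
by rewrite -e => /(is_extE _ dP')[->|].
Qed.

Lemma union_exists a : exists b : hset A,
  forall v w, smem w a -> isin v w -> smem v b.
Proof. by case: kpu => _ [_ un _ _]; exact: un. Qed.

(** Collection over [b] gives, for each [v], a set holding the pairs with first entry [v];
    collection over [a], followed by a union, assembles these sets. *)
Lemma product_superset (a b : hset A) : exists P : hset A,
  forall v w q, smem v a -> smem w b -> is_pair q v w -> smem q P.
Proof.
have d1 v : definable2 [:: v] (fun w q => is_pair q v w).
  move=> K Kps u q uP qP; have vP := Kps v (or_introl erefl).
  by dfn_auto.
have d2 : definable2 [:: inr b] (fun v P => forall w, isin w (inr b) ->
    exists2 q, isin q P & is_pair q v w).
  move=> K Kps v P vP PP; have bP := Kps _ (or_introl erefl).
  by dfn_auto.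
have [v _|Z ZP] := collection (a := a) d2.
  have [w _|P PP] := collection (a := b) (d1 v); first exact: pair_exists.
  by exists (inr P).
have [U UP] := union_exists Z; exists U => v w q /ZP[P PZ PP] /PP[q' q'P vw'] vw.
by rewrite (pair_uniq vw vw'); exact: UP PZ q'P.
Qed.

(** Collection bounds the values, the product bounds the pairs, and $\Delta_0$ separation then cuts
    out exactly the graph. *)
Lemma replacement ps (Q : elt A -> elt A -> Prop) a : definable2 ps Q ->
  (forall v, smem v a -> exists w, Q v w) ->
  (forall v w w', smem v a -> Q v w -> Q v w' -> w = w') ->
  exists u, is_ext u (fun q => exists v w, [/\ smem v a, Q v w & is_pair q v w]).
Proof.
move=> dQ tQ uQ; have [b bP] := collection dQ tQ.
have [P PP] := product_superset a b.
have d : definable1 (inr a :: inr b :: ps) (fun q => exists2 v, isin v (inr a) &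
   exists2 w, isin w (inr b) & Q v w /\ is_pair q v w).
  move=> K Kps q qP.
  have aP := Kps _ (or_introl erefl).
  have bP' := Kps _ (or_intror (or_introl erefl)).
  have psP c : List.In c ps -> isvar (fun _ : carrier K => c).
    by move=> cps; apply: Kps; right; right.
  clear Kps.
  apply: dfn_bex => // K1 f1 v1 l1 vP1; apply: dfn_bex => [|K2 f2 v2 l2 vP2]; first exact: (l1 _ bP').
  apply: dfn_and; last by apply: dfn_pair => //; [exact: (l2 _ (l1 _ qP))|exact: (l2 _ vP1)].
  apply: dQ => //; last exact: (l2 _ vP1).
  by move=> c cps; exact: (l2 _ (l1 _ (psP c cps))).
have [c cP] := separation P d; exists (inr c), c => // q; rewrite cP; split.
  by case=> _ [v va [w wb [vw qvw]]]; exists v, w; split.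
move=> [v [w [va vw qvw]]]; have [w' w'b vw'] := bP v va.
have e := uQ _ _ _ va vw vw'; subst w'.
by split; [exact: PP qvw|exists v => //; exists w].
Qed.

End KPUTheory.

(** * Multicodes *)

Section Codes.
Variables (L : language) (A : structure L) (kpu : KPU A).
Variables (iota : nat -> elt A) (W : hset A) (iota_inj : injective iota).
Hypothesis WP : forall v, smem v W <-> exists n, v = iota n.

Let zero : elt A := inr (emp A).

Definition omega_fun (u : elt A) (c : nat -> elt A) :=
  is_ext u (fun q => exists n, is_pair q (iota n) (c n)).

Lemma omega_fun_exists ps Q c : definable2 ps Q ->
  (forall n w, Q (iota n) w <-> w = c n) -> exists u, omega_fun u c.
Proof.
move=> dQ Qc; have [v /WP[n ->]|v w w' /WP[n ->]|u uP] := replacement (a := W) kpu dQ.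
- by exists (c n); apply/Qc.
- by move=> /Qc-> /Qc->.
exists u; apply: is_ext_iff uP => q; split.
  by move=> [_ [w [/WP[n ->] /Qc-> qP]]]; exists n.
by move=> [n nq]; exists (iota n), (c n); split=> //; [apply/WP; exists n|apply/Qc].
Qed.

Section OmegaFun.
Variables (u : elt A) (c : nat -> elt A) (uc : omega_fun u c).

Lemma omega_fun_maps v w : maps u v w <-> exists2 n, v = iota n & w = c n.
Proof.
split=> [[q /(is_extE _ uc)[n qn] qvw]|[n -> ->]].
  by have [-> ->] := pair_inj kpu qvw qn; exists n.
have [q qP] := pair_exists kpu (iota n) (c n); exists q => //.
by apply/(is_extE _ uc); exists n.
Qed.

Lemma omega_fun_maps_iota n w : maps u (iota n) w <-> w = c n.
Proof.
rewrite omega_fun_maps; split=> [[m /iota_inj -> ->]//|->]; by exists n.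
Qed.

Lemma omega_fun_is_fun : Defs.is_fun u.
Proof.
split; first by case: uc => a -> _; exists a.
  by move=> q /(is_extE _ uc)[n qn]; exists (iota n), (c n).
move=> q q' v w w' qu q'u qvw q'vw'.
have /omega_fun_maps[n vn ->] : maps u v w by exists q.
have : maps u v w' by exists q'.
by rewrite vn omega_fun_maps_iota.
Qed.

Lemma omega_fun_dom v : fdom u v <-> exists n, v = iota n.
Proof.
split=> [[w /omega_fun_maps[n -> _]]|[n ->]]; first by exists n.
by exists (c n); apply/omega_fun_maps_iota.
Qed.

Lemma omega_fun_rng w : frng u w <-> exists n, w = c n.
Proof.
split=> [[v /omega_fun_maps[n _ ->]]|[n ->]]; first by exists n.
by exists (iota n); apply/omega_fun_maps_iota.
Qed.

End OmegaFun.

Variables (one : elt A) (one_one : is_one one).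

Lemma one_neq_zero : one <> zero.
Proof.
move=> e; have : isin zero one by apply/(is_extE _ one_one).
by rewrite e => /(is_extE _ (ext_zero kpu)).
Qed.

Definition bit (p : Prop) : elt A := if `[< p >] then one else zero.

Lemma bit_one (p : Prop) : bit p = one <-> p.
Proof.
rewrite /bit; case: asboolP => pP; split=> // e; case: one_neq_zero.
by rewrite e.
Qed.

Lemma bitE (p : Prop) w : (p /\ w = one) \/ (~ p /\ w = zero) <-> w = bit p.
Proof.
rewrite /bit; case: asboolP => pP; split=> [[[]|[]]|] //; by [left|right].
Qed.

Definition char_code (u : elt A) (D : nat -> Prop) := omega_fun u (fun n => bit (D n)).

Lemma definable_bit ps Q (K : ctx A) (u v w : carrier K -> elt A) :
  definable2 ps Q -> (forall c, List.In c ps -> isvar (fun _ : carrier K => c)) ->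
  isvar (fun _ : carrier K => one) -> isvar (fun _ : carrier K => zero) ->
  isvar u -> isvar v -> isvar w ->
  dfn (fun s => Q (u s) (v s) /\ w s = one \/ ~ Q (u s) (v s) /\ w s = zero).
Proof.
move=> dQ psP oneP zeroP uP vP wP.
apply: dfn_or; (apply: dfn_and; last exact: dfn_eq).
  exact: dQ.
by apply: dfn_not; exact: dQ.
Qed.

Variables (ps : seq (elt A)) (theta : elt A -> elt A -> Prop).
Hypothesis dtheta : definable2 ps theta.

Let D m n := theta (iota m) (iota n).

Lemma char_code_exists m : exists u, char_code u (D m).
Proof.
pose Q l w := (theta (iota m) l /\ w = one) \/ (~ theta (iota m) l /\ w = zero).
apply: (@omega_fun_exists [:: iota m, one, zero & ps] Q) => [|n w]; last exact: bitE.
move=> K Kps u v uP vP; apply: definable_bit dtheta _ _ _ _ _ _ => //.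
- by move=> c cps; apply: Kps; right; right; right.
- by apply: Kps; right; left.
- by apply: Kps; right; right; left.
- by apply: Kps; left.
Qed.

(** The $\Delta_0$ counterpart of [char_code]: quantification over standard numbers is replaced by
    quantification over members of [W] and of [u], so that collection applies. *)
Definition char_rel m u := is_set u /\
  (let H q l := (theta m l /\ is_pair q l one) \/ (~ theta m l /\ is_pair q l zero) in
   (forall q, isin q u -> exists2 l, isin l (inr W : elt A) & H q l) /\
   (forall l, isin l (inr W : elt A) -> exists2 q, isin q u & H q l)).

Lemma char_relE m u : char_rel (iota m) u <-> char_code u (D m).
Proof.
have HE n q : (theta (iota m) (iota n) /\ is_pair q (iota n) one) \/
    (~ theta (iota m) (iota n) /\ is_pair q (iota n) zero) <->
    is_pair q (iota n) (bit (D m n)).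
  rewrite /bit /D; case: asboolP => pP; split=> [[[]|[]]|] //; by [left|right].
split=> [[[a ->] [aW Wa]]|[a -> aP]].
  exists a => // q; split.
    by move=> /aW[_ /WP[n ->] /HE]; exists n.
  move=> [n qn]; have [|q' q'a /HE q'n] := Wa (iota n); first by apply/WP; exists n.
  by rewrite (pair_uniq kpu qn q'n).
split; first by exists a.
split=> [q /aP[n qn]|_ /WP[n ->]].
  by exists (iota n); [apply/WP; exists n|apply/HE].
have [q qn] := pair_exists kpu (iota n) (bit (D m n)).
by exists q; [apply/aP; exists n|apply/HE].
Qed.

Lemma definable_char_rel : definable2 [:: inr W, one, zero & ps] char_rel.
Proof.
move=> K Kps m u mP uP.
have WP' := Kps _ (or_introl erefl).
have oneP := Kps _ (or_intror (or_introl erefl)).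
have zeroP := Kps _ (or_intror (or_intror (or_introl erefl))).
have psP c : List.In c ps -> isvar (fun _ : carrier K => c).
  by move=> cps; apply: Kps; do 3 right.
clear Kps.
have HP (K1 : ctx A) (f1 : carrier K1 -> carrier K) (q l : carrier K1 -> elt A) :
    (forall v, isvar v -> isvar (fun s => v (f1 s))) -> isvar q -> isvar l ->
    dfn (fun s => (theta (m (f1 s)) (l s) /\ is_pair (q s) (l s) one) \/
                  (~ theta (m (f1 s)) (l s) /\ is_pair (q s) (l s) zero)).
  move=> l1 qP lP.
  have dth : dfn (fun s => theta (m (f1 s)) (l s)).
    by apply: dtheta => // [c cps|]; [exact: (l1 _ (psP c cps))|exact: (l1 _ mP)].
  apply: dfn_or; apply: dfn_and; [exact: dth| |exact: dfn_not|].
    by apply: dfn_pair => //; exact: (l1 _ oneP).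
  by apply: dfn_pair => //; exact: (l1 _ zeroP).
apply: dfn_and; first exact: dfn_set.
apply: dfn_and.
  apply: dfn_ball => // K1 f1 q l1 qP; apply: dfn_bex; first exact: (l1 _ WP').
  move=> K2 f2 l l2 lP; apply: (HP K2 (fun s => f1 (f2 s))) => //; last exact: (l2 _ qP).
  by move=> v vP; exact: (l2 _ (l1 _ vP)).
apply: dfn_ball => // K1 f1 l l1 lP; apply: dfn_bex; first exact: (l1 _ uP).
move=> K2 f2 q l2 qP; apply: (HP K2 (fun s => f1 (f2 s))) => //; last exact: (l2 _ lP).
by move=> v vP; exact: (l2 _ (l1 _ vP)).
Qed.

(** Collection first gathers all level 1 codes into a set [b]. With the existential quantifier over
    codes bounded by [b], the map from [m] to the complementary code is $\Delta_0$ and its graph is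
    a set. *)
Lemma compl_family_exists : exists (c : nat -> elt A) (s : elt A),
  [/\ omega_fun s c & forall m, exists2 u, char_code u (D m) & is_pair (c m) zero u].
Proof.
have tot v : smem v W -> exists u, char_rel v u.
  by move=> /WP[m ->]; have [u um] := char_code_exists m; exists u; apply/char_relE.
have [b bP] := collection kpu definable_char_rel tot.
have [u uP] := choice char_code_exists.
have [c cP] := choice (fun m => pair_exists kpu zero (u m)).
pose Q m w := exists2 v, isin v (inr b : elt A) & char_rel m v /\ is_pair w zero v.
have dQ : definable2 [:: inr b, zero, inr W, one, zero & ps] Q.
  move=> K Kps m w mP wP.
  have bP' := Kps _ (or_introl erefl).
  have zP := Kps _ (or_intror (or_introl erefl)).
  apply: dfn_bex => // K1 f1 v l1 vP; apply: dfn_and.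
    apply: definable_char_rel => // [d dps|]; last exact: (l1 _ mP).
    by apply: (l1 (fun _ => d)); apply: Kps; do 2 right.
  by apply: dfn_pair => //; [exact: (l1 _ wP)|exact: (l1 _ zP)].
have [s sc] : exists s, omega_fun s c.
  apply: (omega_fun_exists dQ) => n w; split.
    move=> [v _ [/char_relE vn wv]]; apply: (pair_uniq kpu wv).
    by rewrite (is_ext_uniq kpu vn (uP n)).
  move=> ->; have [|v vb vn] := bP (iota n); first by apply/WP; exists n.
  exists v => //; split=> //; move/char_relE: vn => vn.
  by rewrite (is_ext_uniq kpu vn (uP n)).
by exists c, s; split=> // m; exists (u m).
Qed.

Lemma two_valued_exists (a b : elt A) : exists s, omega_fun s (fun n => if n == 0%N then a else b).
Proof.
pose Q v w := (v = iota 0 /\ w = a) \/ (v <> iota 0 /\ w = b).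
apply: (@omega_fun_exists [:: iota 0; a; b] Q) => [K Kps u v uP vP|n w].
  have iP := Kps _ (or_introl erefl).
  have aP := Kps _ (or_intror (or_introl erefl)).
  have bP := Kps _ (or_intror (or_intror (or_introl erefl))).
  by rewrite /Q; clear Kps; dfn_auto.
rewrite /Q; case: eqVneq => [->|n0]; first by split=> [[[]|[]]|]//; left.
split=> [[[/iota_inj]|[]]|]//; first by move=> e; rewrite e eqxx in n0.
by move=> ->; right; split=> // /iota_inj e; rewrite e eqxx in n0.
Qed.

End Codes.

(** * Finite ordinals of the model *)

Section Ordinals.
Variables (L : language) (A : structure L) (kpu : KPU A).

Definition successor (z s : elt A) := is_ext s (fun v => isin v z \/ v = z).

Lemma successor_exists z : exists s, successor z s.
Proof.
have [w wP] := unordered_pair kpu z z; have [p pP] := unordered_pair kpu z w.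
case: (pP) => a pa _; have [b bP] := union_exists kpu a.
have zp : smem z a by have := is_extE z pP; rewrite pa => /iffRL; apply; left.
have wp : smem w a by have := is_extE w pP; rewrite pa => /iffRL; apply; right.
have d : definable1 [:: z] (fun v => isin v z \/ v = z).
  by move=> K Kps u uP; have zP := Kps _ (or_introl erefl); clear Kps; dfn_auto.
have [s sP] := separation kpu b d; exists (inr s), s => // v; rewrite sP.
split=> [[]//|vz]; split=> //; case: vz => [vz|->]; first exact: bP zp vz.
by apply: bP wp _; apply/(is_extE _ wP); left.
Qed.

Lemma ordinal_zero : is_ordinal (inr (emp A)).
Proof.
split=> [|v /(is_extE _ (ext_zero kpu))//].
by split=> [|v w /(is_extE _ (ext_zero kpu))//]; exists (emp A).
Qed.

Lemma ordinal_successor z s : is_ordinal z -> successor z s -> is_ordinal s.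
Proof.
move=> [tz zt] zs; split; last by move=> v /(is_extE _ zs)[/zt|->].
split=> [|v w /(is_extE _ zs)[vz|->] wv]; first by case: zs => a ->; exists a.
  by apply/(is_extE _ zs); left; case: tz => _ tz; exact: tz vz wv.
by apply/(is_extE _ zs); left.
Qed.

Lemma finite_successor z s : finite_set [set v | isin v z] -> successor z s ->
  finite_set [set v | isin v s].
Proof.
move=> fz zs; suff -> : [set v | isin v s] = [set v | isin v z] `|` [set z].
  by rewrite finite_setU; split=> //; exact: finite_set1.
by apply/seteqP; split=> v; move/(is_extE _ zs).
Qed.

Lemma successor_zero s : successor (inr (emp A)) s -> is_one s.
Proof.
by apply: is_ext_iff => v; split=> [[/(is_extE _ (ext_zero kpu))|]//|->]; right.
Qed.

End Ordinals.

(** * Levels and decoded values of the multicodes *)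

Section Decode.
Variables (L : language) (A : structure L) (kpu : KPU A).
Variables (iota : nat -> elt A) (W : hset A) (iota_inj : injective iota).
Hypothesis WP : forall v, smem v W <-> exists n, v = iota n.
Variables (X : Type) (B : nat -> set X).

Let zero : elt A := inr (emp A).

Variables (one : elt A) (one_one : is_one one).

Lemma char_code_decode u D : char_code iota one u D ->
  BSigma iota one u /\ Defs.decode iota B u (\bigcup_(n in [set n | D n]) B n).
Proof.
move=> uD; have mu n w := omega_fun_maps_iota kpu iota_inj uD n w.
have Bu : BSigma iota one u.
  apply: BSigma_one one_one _ _ _.
  - exact: (omega_fun_is_fun kpu iota_inj uD).
  - exact: (omega_fun_dom kpu iota_inj uD).
  - move=> w /(omega_fun_rng kpu iota_inj uD)[n ->]; rewrite /bit.
    by case: asboolP => _; [right|left].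
split=> //; have -> : [set n | D n] = [set n | maps u (iota n) one].
  apply/seteqP; split=> n /=; rewrite mu.
    by move=> Dn; apply/esym/bit_one.
  by move/esym/(bit_one kpu one_one).
exact: decode_one.
Qed.

Lemma compl_decode alpha u c S : is_pair c zero u -> BSigma iota alpha u ->
  Defs.decode iota B u S -> BPi iota alpha c /\ Defs.decode iota B c (~` S).
Proof.
move=> cu Bu uS; have Bc : BPi iota alpha c by exact: BPi_compl cu Bu.
by split=> //; exact: decode_compl Bc _ cu uS.
Qed.

(** The sets are indexed by the codes and not by the numbers [n], as [decode] takes its union over
    the range of the function. *)
Lemma omega_fun_decode alpha u c F : gt_one alpha -> succ_ordinal alpha ->
  omega_fun iota u c ->
  (forall n, exists2 beta, isin beta alpha &
    BPi iota beta (c n) \/ BSigma iota beta (c n)) ->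
  (forall n, Defs.decode iota B (c n) (F (c n))) ->
  BSigma iota alpha u /\ Defs.decode iota B u (\bigcup_n F (c n)).
Proof.
move=> a1 sa uc cB cF.
have Bu : BSigma iota alpha u.
  apply: BSigma_gt1 => //.
  - exact: (omega_fun_is_fun kpu iota_inj uc).
  - by move=> _; exact: (omega_fun_dom kpu iota_inj uc).
  - by move=> w /(omega_fun_rng kpu iota_inj uc)[n ->].
split=> //.
have -> : \bigcup_n F (c n) = \bigcup_(w in [set w | frng u w]) F w.
  apply/seteqP; split=> y.
    by move=> [n _ yn]; exists (c n) => //; apply/(omega_fun_rng kpu iota_inj uc); exists n.
  by move=> [w /(omega_fun_rng kpu iota_inj uc)[n ->] yn]; exists n.
by apply: decode_gt1 a1 Bu _ => w /(omega_fun_rng kpu iota_inj uc)[n ->].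
Qed.

Variables (two three : elt A).
Hypotheses (zero_one : successor zero one) (one_two : successor one two)
  (two_three : successor two three).

Let ord1 : is_ordinal one.
Proof. exact: (ordinal_successor (ordinal_zero kpu) zero_one). Qed.
Let ord2 : is_ordinal two. Proof. exact: (ordinal_successor ord1 one_two). Qed.
Let ord3 : is_ordinal three. Proof. exact: (ordinal_successor ord2 two_three). Qed.
Let in12 : isin one two. Proof. by apply/(is_extE _ one_two); right. Qed.
Let in13 : isin one three. Proof. by apply/(is_extE _ two_three); left. Qed.
Let in23 : isin two three. Proof. by apply/(is_extE _ two_three); right. Qed.
Let gt2 : gt_one two. Proof. by split=> //; exists one. Qed.
Let gt3 : gt_one three. Proof. by split=> //; exists one. Qed.
Let succ2 : succ_ordinal two. Proof. by exists one. Qed.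
Let succ3 : succ_ordinal three. Proof. by exists two. Qed.

Definition pi_family (D : nat -> nat -> Prop) : set X :=
  \bigcup_m ~` \bigcup_(n in [set n | D m n]) B n.

Variables (ps : seq (elt A)) (theta : elt A -> elt A -> Prop).
Hypothesis dtheta : definable2 ps theta.

Let D m n := theta (iota m) (iota n).

Lemma pi_family_code : exists c s, [/\ omega_fun iota s c,
  forall m, exists u, is_pair (c m) zero u,
  BSigma iota two s & Defs.decode iota B s (pi_family D)].
Proof.
have [c [s [sc cP]]] := compl_family_exists kpu WP one dtheta.
(* [F] reads the set off the code alone: the second component of the pair is a characteristic
   function. *)
pose F w := ~` \bigcup_(n in [set n | exists2 u, is_pair w zero u & maps u (iota n) one]) B n.
have cu m : exists u, is_pair (c m) zero u by have [u _ um] := cP m; exists u.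
have FE m : F (c m) = ~` \bigcup_(n in [set n | D m n]) B n.
  rewrite /F; congr (~` _); suff -> : [set n | exists2 u, is_pair (c m) zero u &
    maps u (iota n) one] = [set n | D m n] by [].
  have [u um cmu] := cP m.
  have mu n w := omega_fun_maps_iota kpu iota_inj um n w.
  apply/seteqP; split=> n /=.
    move=> [u' /(pair_inj kpu cmu)[_ <-]] /mu/esym.
    by move/(bit_one kpu one_one).
  by move=> Dn; exists u => //; apply/mu/esym/(bit_one kpu one_one).
have cB m : BPi iota one (c m) /\ Defs.decode iota B (c m) (F (c m)).
  have [u /char_code_decode[Bu uD] cmu] := cP m.
  by rewrite FE; exact: (compl_decode cmu Bu uD).
have [|m|Bs sS] := @omega_fun_decode two s c F gt2 succ2 sc.
- by move=> m; exists one => //; left; case: (cB m).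
- by case: (cB m).
exists c, s; split=> //; have -> // : pi_family D = \bigcup_m F (c m).
by apply: eq_bigcupr => m _; rewrite FE.
Qed.

Variables (ps0 : seq (elt A)) (theta0 : elt A -> elt A -> Prop).
Hypothesis dtheta0 : definable2 ps0 theta0.

Let D0 n := theta0 (iota 0) (iota n).

(** With the second union taken to be the open complement of $C$, the decoded set is $C\setminus S$.
    Its code negates a level 3 union of a level 2 code and a level 1 code. *)
Lemma compl_union_code : exists s, BPi iota three s /\
  Defs.decode iota B s (~` (pi_family D `|` \bigcup_(n in [set n | D0 n]) B n)).
Proof.
have [c [s [sc cz Bs sS]]] := pi_family_code.
have [u0 u0D] := char_code_exists kpu WP one dtheta0 0.
have [Bu0 uO] := char_code_decode u0D.
set O := \bigcup_(n in [set n | D0 n]) B n in uO *.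
(* [F] below tells the two codes apart: the values of s are pairs, those of u0 bits. *)
have su : s <> u0.
  move=> e; have [u c0] := cz 0%N.
  have : frng s (c 0%N) by apply/(omega_fun_rng kpu iota_inj sc); exists 0%N.
  rewrite e => /(omega_fun_rng kpu iota_inj u0D)[n cn].
  have [v [w [vP _ cP]]] := c0.
  have : isin v (c 0%N) by apply/(is_extE _ cP); left.
  rewrite cn /bit; case: asboolP => _; last by move/(is_extE _ (ext_zero kpu)).
  move/(is_extE _ one_one) => v0; have : isin zero v by apply/(is_extE _ vP).
  by rewrite v0 => /(is_extE _ (ext_zero kpu)).
have [s3 s3P] := two_valued_exists kpu iota_inj WP s u0.
pose F w := if `[< w = s >] then pi_family D else O.
have Fs : F s = pi_family D by rewrite /F; case: asboolP.
have Fu : F u0 = O by rewrite /F; case: asboolP => // /esym.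
have [|n|Bs3 s3S] := @omega_fun_decode three s3 _ F gt3 succ3 s3P.
- by move=> n; case: eqP => _; [exists two => //; right|exists one => //; right].
- by case: eqP => _; [rewrite Fs|rewrite Fu].
have [p pP] := pair_exists kpu zero s3; exists p.
have -> : pi_family D `|` O = \bigcup_n F (if n == 0%N then s else u0).
  apply/seteqP; split=> y.
    by case=> yy; [exists 0%N; rewrite //= Fs|exists 1%N; rewrite //= Fu].
  by move=> [n _]; case: eqP => _; [rewrite Fs; left|rewrite Fu; right].
exact: (compl_decode pP Bs3 s3S).
Qed.

End Decode.

(** * Definability of the separating families *)

Lemma preimage_fset (g g' : nat -> nat) n : cancel g g' -> cancel g' g ->
  exists d : {fset nat}, forall i, (i \in d) = (g i < n)%N.
Proof.
move=> gK g'K; exists [fset g' j | j in iota 0 n]%fset => i.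
apply/imfsetP/idP => [[j /= + ->]|gin]; first by rewrite g'K mem_iota.
by exists (g i) => /=; [rewrite mem_iota|rewrite gK].
Qed.

Section OrbitCodes.
Variables (L : language) (A : structure L) (kpu : KPU A).
Variables (iota : nat -> elt A) (W r f : hset A) (iota_inj : injective iota).
Hypothesis WP : forall v, smem v W <-> exists n, v = iota n.
Hypothesis rP : forall q, smem q r <->
  exists m n, (m < n)%N /\ is_pair q (iota m) (iota n).
Variables (G : set baire) (hG : closed_subgroup G) (T : topologicalType).
Variables (act : baire -> T -> T) (hact : is_action G act) (B : nat -> set T) (x : T).
Hypothesis f_in : forall s, Sfin s -> exists2 q, smem q f & F1_entry iota G act B x s q.
Hypothesis f_out : forall q, smem q f -> exists2 s, Sfin s & F1_entry iota G act B x s q.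

Definition below (i j : elt A) := exists2 q, isin q (inr r : elt A) & is_pair q i j.

Lemma belowE m n : below (iota m) (iota n) <-> (m < n)%N.
Proof.
split=> [[q /rP[m' [n' [mn qmn]]] q']|mn].
  by have [/iota_inj -> /iota_inj ->] := pair_inj kpu q' qmn.
have [q qP] := pair_exists kpu (iota m) (iota n).
by exists q => //; apply/rP; exists m, n.
Qed.

Definition meets_coset g (d : {fset nat}) l :=
  exists h, [/\ G h, forall i, i \in d -> h i = g i & B l (act h x)].

Lemma meets_cosetE g d l :
  setact act (Vstab G (fres g d)) [set x] `&` B l !=set0 <-> meets_coset g d l.
Proof.
split.
  move=> [_ [[h [Gh hd] [_ -> <-]] lh]]; exists h; split=> // i id.
  by have := hd [` id]%fset; rewrite ffunE.
move=> [h [Gh hd lh]]; exists (act h x); split=> //.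
exists h; last by exists x.
by split=> // -[i id]; rewrite ffunE /= hd.
Qed.

(** For $d=g^{-1}\{0,\dots,n-1\}$ the coset $V^G_{g|d}$ equals $V_ng$. So the value of $F_1$ at
    $g|_d$ is exactly the $n$-type of $gx$. *)
Lemma meets_coset_psat g d n l : G g -> (forall i, (i \in d) = (g i < n)%N) ->
  meets_coset g d l <-> psat G act B n l (act g x).
Proof.
move=> Gg dP; have [g' [Gg' gK g'K _ Kg]] := act_inv hG hact Gg.
split=> [[h [Gh hd lh]]|[v [Gv vn] lv]].
  exists (h \o g'); last by rewrite (act_comp hact _ Gh Gg') Kg.
  split; first exact: group_comp.
  by move=> i ni; rewrite /= hd ?g'K // dP g'K.
exists (v \o g); split; first exact: group_comp.
  by move=> i; rewrite dP => /vn.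
by rewrite (act_comp hact _ Gv Gg).
Qed.

Definition codes_entry g d (z y : elt A) := fmap_code iota (fres g d) z /\
  is_ext y (fun v => exists2 l, v = iota l & meets_coset g d l).

Lemma entry_intro g d : G g -> exists q z y,
  [/\ smem q f, is_pair q z y & codes_entry g d z y].
Proof.
move=> Gg; have [g' [_ gK _]] := group_inv hG Gg.
have [|q qf [z [y [zP [_ yP] qP]]]] := @f_in (fres g d).
  move=> [i id] [j jd]; rewrite !ffunE /= => /(can_inj gK) ij.
  exact: val_inj.
exists q, z, y; split=> //; split=> //.
have [|a -> aP] := yP; first by exists g => //; exists d.
exists a => // v; rewrite aP.
by split=> -[l vl]; [move/meets_cosetE|move/meets_cosetE] => ?; exists l.
Qed.

(** A member of the value rules out the default value $\emptyset$ of $F_1$, so the finite map is a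
    restriction of an element of $G$. *)
Lemma entry_elim q z y l : smem q f -> is_pair q z y -> isin l y ->
  exists g d, G g /\ codes_entry g d z y.
Proof.
move=> /f_out[s _ [z' [y' [zP [yN yP] qP]]]] qzy ly.
have [ez ey] := pair_inj kpu qzy qP; subst z' y'.
have [sG|/yN e] := pselect (SfinG G s); last first.
  by move: ly; rewrite e => /(is_extE _ (ext_zero kpu)).
have yP' := yP sG; case: sG => g Gg [d _ e]; subst s.
exists g, d; do 2 split=> //.
apply: is_ext_iff yP' => v.
by split=> -[k vk]; [move/meets_cosetE|move/meets_cosetE] => ?; exists k.
Qed.

Lemma codes_entryE g d z y l : codes_entry g d z y -> isin (iota l) y <-> meets_coset g d l.
Proof.
move=> [_ yP]; rewrite (is_extE _ yP); split=> [[k /iota_inj ->]//|]; by exists l.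
Qed.

Lemma codes_pairE g d z y i j : codes_entry g d z y ->
  (exists2 p, isin p z & is_pair p (iota i) (iota j)) <-> i \in d /\ g i = j.
Proof.
move=> [zP _]; split.
  move=> [p /(is_extE _ zP)[[m md] pm]] pij; move: pm; rewrite ffunE /= => pm.
  by have [/iota_inj -> /iota_inj ->] := pair_inj kpu pij pm.
move=> [id <-]; have [p pP] := pair_exists kpu (iota i) (iota (g i)).
by exists p => //; apply/(is_extE _ zP); exists [` id]%fset; rewrite ffunE.
Qed.

Definition maps_below (k m : elt A) (z : elt A) :=
  forall i, isin i (inr W : elt A) -> below i k ->
  exists2 p, isin p z & exists2 j, isin j (inr W : elt A) & is_pair p i j /\ below j m.

(** Unions over finite maps become a quantifier bounded by the graph [f] of $F_1$. The domain of the
    map coded by [z] may extend beyond [k]; this only shrinks the coset. *)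
Definition misses_bounded k m l := ~ exists2 q, isin q (inr f : elt A) &
  exists z y, is_pair q z y /\ (isin l y /\ maps_below k m z).

Lemma misses_boundedE k m l : misses_bounded (iota k) (iota m) (iota l) <->
  ~ exists h, [/\ G h, forall i, (i < k)%N -> (h i < m)%N & B l (act h x)].
Proof.
split; apply: contra_not.
  move=> [h [Gh hm lh]].
  have [d dP] := @preimage_fset idfun idfun k (fun i => erefl) (fun i => erefl).
  have [q [z [y [qf qzy zyP]]]] := entry_intro d Gh.
  exists q => //; exists z, y; split=> //; split.
    by apply/(codes_entryE _ zyP); exists h; split.
  move=> _ /WP[i ->] /belowE ik.
  have [|p pz pij] := iffRL (codes_pairE i (h i) zyP); first by rewrite dP.
  exists p => //; exists (iota (h i)); first by apply/WP; exists (h i).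
  by split=> //; apply/belowE; exact: hm.
move=> [q qf [z [y [qzy [ly zm]]]]].
have [g [d [Gg zyP]]] := entry_elim qf qzy ly.
have [h [Gh hd lh]] := iffLR (codes_entryE _ zyP) ly.
exists h; split=> // i ik.
have [||p pz [_ /WP[j ->] [pij /belowE jm]]] := zm (iota i).
- by apply/WP; exists i.
- exact/belowE.
have [id gij] : i \in d /\ g i = j by apply/(codes_pairE _ _ zyP); exists p.
by rewrite hd // gij.
Qed.

(** The map coded by [z] has range exactly {0, ..., n-1}; for a restriction of [g] in $G$ this says
    that its domain is the preimage of that set under [g]. *)
Definition range_below z n :=
  (forall p, isin p z -> exists2 i, isin i (inr W : elt A) &
     exists2 j, isin j (inr W : elt A) & is_pair p i j /\ below j n) /\
  (forall j, isin j (inr W : elt A) -> below j n ->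
     exists2 p, isin p z & exists2 i, isin i (inr W : elt A) & is_pair p i j).

Lemma range_belowE g d z y n : G g -> codes_entry g d z y ->
  range_below z (iota n) <-> forall i, (i \in d) = (g i < n)%N.
Proof.
move=> Gg zyP; have [g' [_ gK g'K]] := group_inv hG Gg.
split=> [[zn nz] i|dP].
  apply/idP/idP => [id|gin].
    have [p pz pP] := iffRL (codes_pairE i (g i) zyP) (conj id erefl).
    have [_ /WP[i' ->] [_ /WP[j ->] [pij /belowE jn]]] := zn p pz.
    by have [_ /iota_inj ->] := pair_inj kpu pP pij.
  have [||p pz [_ /WP[i' ->] pP]] := nz (iota (g i)).
  - by apply/WP; exists (g i).
  - exact/belowE.
  have [i'd /(can_inj gK) <-] // : i' \in d /\ g i' = g i.
  by apply/(codes_pairE _ _ zyP); exists p.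
split=> [p pz|_ /WP[j ->] /belowE jn].
  have [zP _] := zyP; have /(is_extE _ zP)[[i id]] := pz.
  rewrite ffunE /= => pP; exists (iota i); first by apply/WP; exists i.
  exists (iota (g i)); first by apply/WP; exists (g i).
  by split=> //; apply/belowE; rewrite -dP.
have [|p pz pP] := iffRL (codes_pairE (g' j) j zyP); first by rewrite dP g'K.
by exists p => //; exists (iota (g' j)) => //; apply/WP; exists (g' j).
Qed.

(** Values of $F_1$ at maps with range {0, ..., n-1} are $n$-types of points of $Gx$, so isolation
    by [l] says that any two such values containing [l] are equal. *)
Definition code_isolating n l := ~ exists2 q, isin q (inr f : elt A) &
  exists z y, is_pair q z y /\
  exists2 q', isin q' (inr f : elt A) & exists z' y', is_pair q' z' y' /\
  ((range_below z n /\ range_below z' n) /\ ((isin l y /\ isin l y') /\ y <> y')).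

Lemma code_isolatingE n l :
  code_isolating (iota n) (iota l) <-> isolating G act B x n l.
Proof.
split=> [nl g h Gg Gh gl hl|nl].
  have [g' [_ gK g'K]] := group_inv hG Gg; have [d dP] := preimage_fset n gK g'K.
  have [h' [_ hK h'K]] := group_inv hG Gh; have [e eP] := preimage_fset n hK h'K.
  have [q [z [y [qf qzy zyP]]]] := entry_intro d Gg.
  have [q' [z' [y' [q'f qzy' zyP']]]] := entry_intro e Gh.
  have [yy|yy] := pselect (y = y').
    move=> k; rewrite -(meets_coset_psat k Gg dP) -(meets_coset_psat k Gh eP).
    by rewrite -(codes_entryE _ zyP) -(codes_entryE _ zyP') yy.
  case: nl; exists q => //; exists z, y; split=> //; exists q' => //.
  exists z', y'; split=> //; split; first split.
  - exact/(range_belowE _ Gg zyP).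
  - exact/(range_belowE _ Gh zyP').
  split=> //; split.
    by apply/(codes_entryE _ zyP)/(meets_coset_psat _ Gg dP).
  by apply/(codes_entryE _ zyP')/(meets_coset_psat _ Gh eP).
move=> [q qf [z [y [qzy [q' q'f [z' [y' [qzy' [[zn zn'] [[ly ly'] yy]]]]]]]]]].
have [g [d [Gg zyP]]] := entry_elim qf qzy ly.
have [h [e [Gh zyP']]] := entry_elim q'f qzy' ly'.
have dP := iffLR (range_belowE _ Gg zyP) zn.
have eP := iffLR (range_belowE _ Gh zyP') zn'.
apply: yy; have [_ yP] := zyP; have [_ yP'] := zyP'.
apply: (is_ext_uniq kpu yP); apply: is_ext_iff yP' => v.
have gh : ptype G act B n (act g x) (act h x).
  apply: nl => //.
    by apply/(meets_coset_psat _ Gg dP)/(codes_entryE _ zyP).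
  by apply/(meets_coset_psat _ Gh eP)/(codes_entryE _ zyP').
split=> -[k vk].
  by move/(meets_coset_psat _ Gh eP)/gh/(meets_coset_psat _ Gg dP) => ?; exists k.
by move/(meets_coset_psat _ Gg dP)/gh/(meets_coset_psat _ Gh eP) => ?; exists k.
Qed.

Lemma definable_misses_bounded k :
  definable2 [:: inr f; inr W; inr r; k] (misses_bounded k).
Proof.
move=> K Kps m l mP lP.
have fP := Kps _ (or_introl erefl).
have WP' := Kps _ (or_intror (or_introl erefl)).
have rP' := Kps _ (or_intror (or_intror (or_introl erefl))).
have kP := Kps _ (or_intror (or_intror (or_intror (or_introl erefl)))).
clear Kps; rewrite /misses_bounded /maps_below /below.
by dfn_auto.
Qed.

Lemma definable_code_isolating : definable2 [:: inr f; inr W; inr r] code_isolating.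
Proof.
move=> K Kps n l nP lP.
have fP := Kps _ (or_introl erefl).
have WP' := Kps _ (or_intror (or_introl erefl)).
have rP' := Kps _ (or_intror (or_intror (or_introl erefl))).
clear Kps; rewrite /code_isolating /range_below /below.
by dfn_auto.
Qed.

End OrbitCodes.

(** * Invariant Borel partitions of the piece *)

Lemma pi_family_borel (X : Type) (t : Topological X) (B : nat -> set X) D :
  (forall l, @open (Defs.space t) (B l)) ->
  <<s [set U : set X | @open (Defs.space t) U] >> (pi_family B D).
Proof.
move=> oB; apply: sigma_algebra_bigcup => m; rewrite -setTD; apply: sigma_algebraCD.
apply: sub_sigma_algebra; apply: (@bigcup_open (Defs.space t)) => n _; exact: oB.
Qed.

(** With $p=gx$ in [P] and $q=hx$ in [Q], the element $hg^{-1}$ carries [p] to [q]. *)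
Lemma orbit_indecomposable (G : set baire) (X : Type) (act : baire -> X -> X) x P Q :
  closed_subgroup G -> is_action G act ->
  invariant_under act G P -> P `|` Q = gorbit act G x ->
  P !=set0 -> Q !=set0 -> P `&` Q !=set0.
Proof.
move=> hG [actid actM] iP PQ [p Pp] [q Qq].
have [g Gg [_ -> gp]] : gorbit act G x p by rewrite -PQ; left.
have [h Gh [_ -> hq]] : gorbit act G x q by rewrite -PQ; right.
have [g' [Gg' gK g'K]] := group_inv hG Gg.
exists q; split=> //; have Ghg := group_comp hG Gh Gg'.
rewrite -(iP _ Ghg); exists p => //; rewrite actM // -gp -(actM g') //.
by have -> : g' \o g = idfun by [apply/funext => i; exact: gK]; rewrite actid.
Qed.

Lemma invariant_underP (G : set baire) (X : Type) (act : baire -> X -> X) P :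
  closed_subgroup G -> is_action G act ->
  (forall g y, G g -> P y -> P (act g y)) -> invariant_under act G P.
Proof.
move=> hG [actid actM] iP g Gg; have [g' [Gg' gK g'K]] := group_inv hG Gg.
apply/seteqP; split=> [_ [y Py <-]|y Py]; first exact: iP.
exists (act g' y); first exact: iP.
rewrite -actM //.
by have -> : g \o g' = idfun by [apply/funext => i; exact: g'K]; rewrite actid.
Qed.

Section Separation.
Variables (R : realType) (G : set baire) (X : topologicalType).
Variables (act : baire -> X -> X) (t : Topological X) (B : nat -> set X) (x : X).
Hypotheses (hG : closed_subgroup G) (hact : is_action G act).
Hypothesis cact : @continuous_action G (Defs.space t) act.
Hypothesis polt : polish R (Defs.space t).
Hypothesis niceB : nice_basis G act t (range B).

Let C : set X := @piece G (Defs.space t) act B x.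

Let cactn := continuous_action_nbhs cact.
Let haus := polish_hausdorff polt.
Let openB := nice_open niceB.
Let nbhsB := nice_nbhs niceB.
Let interB := nice_inter niceB.
Let complB := nice_compl niceB.
Let satB := nice_sat hG cact niceB.

Lemma pi_family_nonatomic :
  pi_family B (fun n l => @isolating G (Defs.space t) act B x n l) =
  [set y | ~ @atomic G (Defs.space t) act B x y].
Proof.
apply/seteqP; split=> y.
  by move=> [n _ ny] /(_ n)[l nl ly]; apply: ny; exists l.
move=> /existsNP[n ny]; exists n => // -[l nl ly]; apply: ny; exists l => //.
Qed.

(** The explicit shape of [D] is kept in the conclusion because its $\Delta_0$ definability is
    derived from it. *)
Lemma separating_family : C <> gorbit act G x ->
  exists D : nat -> nat -> Prop,
    [/\ (D = fun n l => @isolating G (Defs.space t) act B x n l) \/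
        (exists k, D = fun m l => ~ exists h,
           [/\ G h, forall i, (i < k)%N -> (h i < m)%N & B l (act h x)]),
      pi_family B D `<=` C, pi_family B D !=set0, C `\` pi_family B D !=set0 &
      forall g y, G g -> pi_family B D y -> pi_family B D (act g y)].
Proof.
move=> CGx; have GxC g : G g -> C (act g x).
  by move=> Gg; exact: (piece_act hG hact Gg (@piece_x G _ act B x)).
have [ax|nax] := pselect (@atomic G (Defs.space t) act B x x).
  exists (fun n l => @isolating G (Defs.space t) act B x n l).
  rewrite pi_family_nonatomic; split; first by left.
  - move=> y ny; apply: contrapT => nCy; apply: ny.
    exact: (@atomic_out G hG (Defs.space t) act hact B complB satB x y nCy).
  - have [y [Cy ny]] : exists y, C y /\ ~ gorbit act G x y.
      apply: contrapT => nex; apply: CGx; apply/seteqP; split=> y.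
        by move=> Cy; apply: contrapT => ny; apply: nex; exists y.
      by case=> g Gg [_ -> <-]; exact: GxC.
    exists y => /= ay; apply: ny.
    have [g Gg ->] := @atomic_orbit G hG (Defs.space t) act hact B cactn haus openB
      nbhsB interB complB satB x y Cy ay ax.
    by exists g => //; exists x.
  - by exists x; split; [exact: piece_x|].
  - move=> g y Gg /= ny agy; apply: ny.
    have [g' [Gg' _ _ _ gK]] := @act_inv G hG (Defs.space t) act hact g Gg.
    rewrite -[y]gK.
    exact: (@atomic_act G hG (Defs.space t) act hact B cactn openB nbhsB complB satB x).
(* If [x] is not atomic, the separating set consists of the points whose orbit realizes a
   non-isolated [k]-type of [x]; [bounded_closureP] gives it the required form. *)
have [k [y Cy yP]] := @nonatomic G hG (Defs.space t) act hact B cactn openB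
  nbhsB complB satB x R polt nax.
have bc := @bounded_closureP G hG (Defs.space t) act hact B cactn openB
  nbhsB complB satB x k.
pose D m l := ~ exists h,
  [/\ G h, forall i, (i < k)%N -> (h i < m)%N & B l (act h x)].
have DE z : pi_family B D z <-> exists2 g, G g & ptype G act B k (act g z) x.
  rewrite bc; split=> -[m].
    move=> _ zm; exists m => l lz; apply: contrapT => nl; apply: zm.
    by exists l.
  by move=> mz; exists m => // -[l /= nl /mz].
exists D; split; first by right; exists k.
- move=> z /DE[g Gg gz].
  have [g' [Gg' _ _ _ gK]] := @act_inv G hG (Defs.space t) act hact g Gg.
  rewrite -[z]gK; apply: (piece_act hG hact Gg').
  by apply: ptype_sym; exact: (ptypeW hG hact complB satB (leq0n k) gz).
- by exists x; apply/DE; exists idfun; [exact: group_id|rewrite (act_id hact)].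
- by exists y; split=> // /DE[g Gg]; exact: yP.
- move=> g z Gg /DE[h Gh hz]; apply/DE.
  have [g' [Gg' _ _ _ gK]] := @act_inv G hG (Defs.space t) act hact g Gg.
  exists (h \o g'); first exact: group_comp.
  have Ggz := act_comp hact (act g z) Gh Gg'.
  by rewrite Ggz gK.
Qed.

Lemma piece_complement (D0 : nat -> Prop) :
  (forall l, D0 l <-> ~ exists2 h, G h & B l (act h x)) ->
  \bigcup_(l in [set l | D0 l]) B l = ~` C.
Proof.
move=> D0P; apply/seteqP; split=> y.
  move=> [l /D0P nl ly] Cy; apply: nl.
  exact: (@piece_dense G hG (Defs.space t) act hact B x l y Cy ly).
move=> /(@pieceN G (Defs.space t) act B complB satB x)[l ly lC].
exists l => //; apply/D0P => -[h Gh lh]; apply: lC lh _.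
exact: (piece_act hG hact Gh (@piece_x G _ act B x)).
Qed.

End Separation.

Theorem theorem9 (R : realType) (G : set baire) (X : topologicalType)
    (act : baire -> X -> X) (t : Topological X) (B : nat -> set X) (x : X)
    (C : set X) (L : language) (A : structure L) (iota : nat -> elt A) :
  closed_subgroup G ->
  polish_gspace R G act ->
  (exists Bs : set (set X), [/\ countable Bs, basis Bs & Bs `<=` clopen]) ->
  nice_topology R G act t ->
  nice_basis G act t (range B) ->
  C = canonical_piece G act (range B) x ->
  admissible A ->
  codable iota G act B x ->
  sigma_definable3 (Imp_rel iota G act B) ->
  (C = gorbit act G x <->
   ~ exists P Q : set X,
       [/\ P `|` Q = C, P `&` Q = set0, P !=set0 & Q !=set0] /\
       [/\ invariant_under act G P, invariant_under act G Q,
           constructible_borel iota B t P & constructible_borel iota B t Q]).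
Proof.
move=> hG [_ hact _] _ [polt _ cact _] niceB CE [kpu _].
move=> [[iinj [_ [W _ WP]] [_ [r _ rP]]] [f [f_in f_out]]] _.
split=> [CGx [P [Q [[PQ PQ0 P0 Q0] [iP _ _ _]]]]|irr].
  rewrite CGx in PQ.
  have [y] := orbit_indecomposable hG hact iP PQ P0 Q0.
  by rewrite PQ0.
have {}CE : C = @piece G (Defs.space t) act B x by rewrite CE (canonical_pieceE hG hact).
apply: contrapT => CGx; apply: irr.
rewrite CE in CGx; have [D [Dform DC D0 CD iD]] :=
  separating_family hG hact cact polt niceB CGx.
(* In both cases [D] is $\Delta_0$ with the graph of $F_1$, the copy of $\omega$ and its order as
   parameters, together with [k] in the second case. *)
have [ps [theta [dtheta thetaE]]] : exists ps theta,
    @definable2 L A ps theta /\ forall m l, theta (iota m) (iota l) <-> D m l.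
  case: Dform => [->|[k ->]].
    exists [:: inr f; inr W; inr r], (code_isolating W r f).
    split; first exact: definable_code_isolating.
    by move=> m l; exact: (code_isolatingE kpu iinj WP rP hG hact f_in f_out).
  exists [:: inr f; inr W; inr r; iota k], (misses_bounded W r f (iota k)).
  split; first exact: definable_misses_bounded.
  by move=> m l; exact: (misses_boundedE kpu iinj WP rP hG f_in f_out).
have {thetaE}DE : D = fun m l => theta (iota m) (iota l).
  by apply/funext => m; apply/funext => l; apply/propext; rewrite thetaE.
have [one zero_one] := successor_exists kpu (inr (emp A)).
have [two one_two] := successor_exists kpu one.
have [three two_three] := successor_exists kpu two.
have one_one := successor_zero kpu zero_one.
have [c [s [_ _ Bs sS]]] := pi_family_code kpu iinj WP B one_one zero_one one_two dtheta.
(* For [k = 0] the bound on [h] is vacuous, so [misses_bounded] just says that $B_l$ misses $Gx$.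
   The union of these $B_l$ is the complement of $C$. *)
have [s' [Bs' sS']] := compl_union_code kpu iinj WP B one_one zero_one one_two
  two_three dtheta (definable_misses_bounded (W := W) (r := r) (f := f) (k := iota 0)).
have ord2 := ordinal_successor (ordinal_successor (ordinal_zero kpu) zero_one) one_two.
have fin2 : finite_set [set v | isin v two].
  apply: finite_successor one_two; apply: finite_successor zero_one.
  suff -> : [set v | isin v (inr (emp A) : elt A)] = set0 by [].
  by rewrite -subset0 => v /(is_extE _ (ext_zero kpu)).
have oB := nice_open niceB.
have bS := pi_family_borel D oB.
have compE : C `\` pi_family B D = ~` (pi_family B D `|` ~` C).
  by rewrite setCU setCK setIC setDE.
have OE : \bigcup_(l in [set l | misses_bounded W r f (iota 0) (iota 0) (iota l)]) B l = ~` C.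
  have H := @piece_complement G X act t B x hG hact cact niceB
    (fun l => misses_bounded W r f (iota 0) (iota 0) (iota l)).
  rewrite CE H // => l.
  rewrite (misses_boundedE kpu iinj WP rP hG f_in f_out).
  split; apply: contra_not; first by move=> [h Gh lh]; exists h.
  by move=> [h [Gh _ lh]]; exists h.
rewrite OE -DE -compE in sS'; rewrite -DE in sS.
exists (C `\` pi_family B D), (pi_family B D); split; split.
- by rewrite setUC setDUK // CE.
- exact: setDKI.
- by rewrite CE.
- exact: D0.
- apply: invariant_underP => // g y Gg [Cy nDy]; split.
    by move: Cy; rewrite CE; exact: (piece_act hG hact Gg).
  move=> Dgy; apply: nDy.
  have [g' [Gg' _ _ _ gK]] := act_inv hG hact Gg.
  by rewrite -[y]gK; exact: iD.
- exact: invariant_underP.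
- split.
    rewrite compE -setTD; apply: sigma_algebraCD.
    rewrite -bigcup2E; apply: sigma_algebra_bigcup => -[|[|i]] //=.
      rewrite -OE; apply: sub_sigma_algebra.
      by apply: (@bigcup_open (Defs.space t)) => n _; exact: oB.
    exact: sigma_algebra0.
  exists three, s'; split=> //; last by right.
    exact: (ordinal_successor ord2 two_three).
  exact/finite_set_countable/(finite_successor fin2 two_three).
- split; first exact: bS.
  by exists two, s; split=> //; [exact: finite_set_countable|left].
Qed.
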